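(* Let $\mathfrak{L}$ be a left Leibniz algebra over a field $\mathbb{F}$ of characteristic zero. Then the following statements are equivalent: (i) $\mathfrak{L}$ is finite-dimensional semi-simple. (ii) There exists a finite-dimensional semi-simple Lie subalgebra $\mathfrak{g}$ of $\mathfrak{L}$ such that $\mathfrak{L}=\mathfrak{g}\oplus\mathrm{Leib}(\mathfrak{L})$ (as vector spaces), and $\mathrm{Leib}(\mathfrak{L})$ is a finite-dimensional completely reducible anti-symmetric $\mathfrak{g}$-bimodule that does not contain any non-zero trivial $\mathfrak{g}$-subbimodule. (iii) $\mathfrak{L}$ is isomorphic to the left hemi-semidirect product $\mathfrak{g}\ltimes_\ell M$ of a finite-dimensional semi-simple Lie algebra $\mathfrak{g}$ over $\mathbb{F}$ and a finite-dimensional completely reducible left $\mathfrak{g}$-module $M$ that does not contain any non-zero trivial $\mathfrak{g}$-submodule.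
   Context: A left Leibniz algebra is an $\mathbb{F}$-vector space $\mathfrak{L}$ with a bilinear multiplication satisfying $x(yz)=(xy)z+y(xz)$ for all $x,y,z\in\mathfrak{L}$. Ideals are two-sided. The Leibniz kernel is the ideal $\mathrm{Leib}(\mathfrak{L}):=\langle x^2\mid x\in\mathfrak{L}\rangle_{\mathbb{F}}$ (the linear span of all squares). A Leibniz algebra $\mathfrak{L}$ is semi-simple if $\mathrm{Leib}(\mathfrak{L})$ contains every solvable ideal of $\mathfrak{L}$; for Lie algebras (Leibniz kernel $0$) this means that the only solvable ideal is $0$. A Lie subalgebra of $\mathfrak{L}$ is a subalgebra that is a Lie algebra under the multiplication of $\mathfrak{L}$. A bimodule over a left Leibniz algebra $\mathfrak{L}$ is a vector space $M$ with bilinear left and right actions such that for all $x,y\in\mathfrak{L}$, $m\in M$: $(xy)\cdot m=x\cdot(y\cdot m)-y\cdot(x\cdot m)$, $(x\cdot m)\cdot y=x\cdot(m\cdot y)-m\cdot(xy)$, and $(m\cdot x)\cdot y=m\cdot(xy)-x\cdot(m\cdot y)$. It is anti-symmetric if its right action is zero, and trivial if both actions are zero. A subalgebra $\mathfrak{g}$ of $\mathfrak{L}$ acts on $\mathrm{Leib}(\mathfrak{L})$ by left and right multiplication in $\mathfrak{L}$. A left module is trivial if its left action is zero. A completely reducible (bi)module (direct sum of irreducible ones) is allowed to be zero; irreducible (bi)modules are non-zero. For a Lie algebra $\mathfrak{g}$ and a left $\mathfrak{g}$-module $M$, the left hemi-semidirect product $\mathfrak{g}\ltimes_\ell M$ is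 the left Leibniz algebra with underlying vector space $\mathfrak{g}\times M$ and multiplication $(g,m)(g',m'):=([g,g'],g\cdot m')$. *)

(* Defs.v *)
From HB Require Import structures.
From mathcomp Require Import all_boot all_order all_algebra.
From mathcomp Require Import boolp classical_sets.

Set Implicit Arguments.
Unset Strict Implicit.
Unset Printing Implicit Defensive.

Import GRing.Theory.
Local Open Scope classical_set_scope.
Local Open Scope ring_scope.

(* Carriers may be infinite-dimensional, so subspaces are classical sets
   rather than the {vspace _} of a vectType. *)

Section Subspaces.
Variables (F : fieldType) (V : lmodType F).
Implicit Types A B W : set V.

Definition subspace W : Prop := GRing.submod_closed (mem W).

Definition span A : set V := smallest subspace A.

Definition fin_dim W : Prop := exists s : seq V, W = span [set` s].

Definition direct_sum2 W A B : Prop :=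
  W = [set a + b | a in A & b in B] /\ A `&` B = [set 0].

(* [W] is the internal direct sum of the [N i]; the index type is arbitrary,
   possibly empty, in which case [W] is zero. *)
Definition direct_sum (I : choiceType) (N : I -> set V) W : Prop :=
  W = span (\bigcup_i N i) /\
  forall (s : seq I) (v : I -> V), uniq s -> (forall i, N i (v i)) ->
    \sum_(i <- s) v i = 0 -> forall i, i \in s -> v i = 0.

(* Irreducibility and complete reducibility with respect to a notion [sub] of
   submodule, to be instantiated by submodules or sub-bimodules. *)
Definition irreducible (sub : set V -> Prop) W : Prop :=
  [/\ sub W, W <> [set 0]
    & forall N, sub N -> N `<=` W -> N = [set 0] \/ N = W].

Definition completely_reducible (sub : set V -> Prop) W : Prop :=
  exists (I : choiceType) (N : I -> set V),
    (forall i, irreducible sub (N i)) /\ direct_sum N W.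

End Subspaces.

HB.mixin Record isLeftLeibniz (F : fieldType) L of GRing.Lmodule F L := {
  lmul : {bilinear L -> L -> L};
  left_leibniz : forall x y z : L,
    lmul x (lmul y z) = lmul (lmul x y) z + lmul y (lmul x z)
}.

#[short(type="leibnizType")]
HB.structure Definition LeftLeibniz (F : fieldType) :=
  { L of GRing.Lmodule F L & isLeftLeibniz F L }.

Notation "x ** y" := (lmul x y) (at level 40, left associativity) : ring_scope.

(* Notions for a subalgebra [G] of an ambient algebra [L]; the notions for [L]
   itself are the case [G = setT]. *)
Section Algebras.
Variables (F : fieldType) (L : leibnizType F).
Implicit Types G I : set L.

Definition subalgebra G : Prop :=
  subspace G /\ forall x y, G x -> G y -> G (x ** y).

Definition ideal G I : Prop :=
  [/\ subspace I, I `<=` G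
    & forall x y, G x -> I y -> I (x ** y) /\ I (y ** x)].

Definition leib G : set L := span [set x ** x | x in G].

Fixpoint derived (n : nat) I : set L :=
  if n is m.+1 then span [set x ** y | x in derived m I & y in derived m I]
  else I.

Definition solvable I : Prop := exists n, derived n I = [set 0].

Definition semisimple G : Prop :=
  forall I, ideal G I -> solvable I -> I `<=` leib G.

Definition lie G : Prop :=
  (forall x, G x -> x ** x = 0) /\
  (forall x y z, G x -> G y -> G z ->
     x ** (y ** z) + y ** (z ** x) + z ** (x ** y) = 0).

End Algebras.

HB.mixin Record isLeftModule (F : fieldType) (L : leibnizType F) M
    of GRing.Lmodule F M := {
  lact : {bilinear L -> M -> M};
  lactM : forall (x y : L) (m : M),
    lact (x ** y) m = lact x (lact y m) - lact y (lact x m)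
}.

#[short(type="leftModType")]
HB.structure Definition LeftModule (F : fieldType) (L : leibnizType F) :=
  { M of GRing.Lmodule F M & isLeftModule F L M }.

HB.mixin Record isBimodule (F : fieldType) (L : leibnizType F) M
    of LeftModule F L M := {
  ract : {bilinear M -> L -> M};
  lact_ract : forall (x y : L) (m : M),
    ract (lact x m) y = lact x (ract m y) - ract m (x ** y);
  ract_ract : forall (x y : L) (m : M),
    ract (ract m x) y = ract m (x ** y) - lact x (ract m y)
}.

#[short(type="bimodType")]
HB.structure Definition Bimodule (F : fieldType) (L : leibnizType F) :=
  { M of LeftModule F L M & isBimodule F L M }.

(* Modules over a subalgebra [G] of [L] are taken inside an [L]-module [M],
   only the action of the elements of [G] being considered. *)
Section Modules.
Variables (F : fieldType) (L : leibnizType F) (G : set L).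

Definition submodule (M : leftModType L) (N : set M) : Prop :=
  subspace N /\ forall x m, G x -> N m -> N (lact x m).

Definition trivial_lmod (M : leftModType L) (N : set M) : Prop :=
  forall x m, G x -> N m -> lact x m = 0.

Definition subbimodule (M : bimodType L) (N : set M) : Prop :=
  submodule N /\ forall x m, G x -> N m -> N (ract m x).

Definition antisymmetric_bimod (M : bimodType L) (N : set M) : Prop :=
  forall x m, G x -> N m -> ract m x = 0.

Definition trivial_bimod (M : bimodType L) (N : set M) : Prop :=
  trivial_lmod N /\ antisymmetric_bimod N.

End Modules.

(* [L] as a bimodule over itself by left and right multiplication. *)
Definition adjoint (F : fieldType) (L : leibnizType F) : Type := L.

Section Adjoint.
Variables (F : fieldType) (L : leibnizType F).

HB.instance Definition _ := GRing.Lmodule.on (adjoint L).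

Let mulL : {bilinear L -> adjoint L -> adjoint L} := @lmul F L.
Let mulR : {bilinear adjoint L -> L -> adjoint L} := @lmul F L.

Fact adjoint_lactM (x y : L) (m : adjoint L) :
  mulL (x ** y) m = mulL x (mulL y m) - mulL y (mulL x m).
Proof. by apply/esym/eqP; rewrite subr_eq; apply/eqP; exact: left_leibniz. Qed.

HB.instance Definition _ :=
  isLeftModule.Build F L (adjoint L) adjoint_lactM.

Fact adjoint_lact_ract (x y : L) (m : adjoint L) :
  mulR (lact x m) y = lact x (mulR m y) - mulR m (x ** y).
Proof. by apply/esym/eqP; rewrite subr_eq; apply/eqP; exact: left_leibniz. Qed.

Fact adjoint_ract_ract (x y : L) (m : adjoint L) :
  mulR (mulR m x) y = mulR m (x ** y) - lact x (mulR m y).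
Proof. by apply/esym/eqP; rewrite subr_eq; apply/eqP; exact: left_leibniz. Qed.

HB.instance Definition _ :=
  isBimodule.Build F L (adjoint L) adjoint_lact_ract adjoint_ract_ract.

End Adjoint.

(* Left hemi-semidirect product, on the vector space [g * M]. *)
Definition hemi (F : fieldType) (g : leibnizType F) (M : leftModType g) : Type :=
  (g * M)%type.

Section Hemi.
Variables (F : fieldType) (g : leibnizType F) (M : leftModType g).

HB.instance Definition _ := GRing.Lmodule.on (hemi M).

Definition hemi_mul (a b : hemi M) : hemi M := (a.1 ** b.1, lact a.1 b.2).

Fact hemi_mul_bilinear : bilinear_for *:%R *:%R hemi_mul.
Proof.
split=> [b | b] c u v; congr pair => /=;
  by rewrite ?(linearPl, linearPr).
Qed.

HB.instance Definition _ :=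
  bilinear_isBilinear.Build F (hemi M) (hemi M) (hemi M) *:%R *:%R hemi_mul
    hemi_mul_bilinear.

Fact hemi_leibniz (x y z : hemi M) :
  hemi_mul x (hemi_mul y z) =
  hemi_mul (hemi_mul x y) z + hemi_mul y (hemi_mul x z).
Proof.
congr pair => /=; first exact: left_leibniz.
by rewrite lactM subrK.
Qed.

HB.instance Definition _ := isLeftLeibniz.Build F (hemi M) hemi_leibniz.

End Hemi.

Definition isomorphic (F : fieldType) (L L' : leibnizType F) : Prop :=
  exists f : {linear L -> L'},
    bijective f /\ forall x y, f (x ** y) = f x ** f y.

(* Main.v *)
(** Since [x^2 y = 0], the Leibniz kernel [K] acts trivially on [L] from the left,
    so that the left multiplications make [L] a module over the Lie algebra
    [L / K], which is semisimple when [L] is.  By Weyl's theorem [K] then has a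
    complement [G] stable under left multiplication.  Such a [G] is a subalgebra,
    and its squares lie in [G] and in [K], hence vanish: [G] is a Lie algebra.
    Conversely, complete reducibility and the absence of trivial submodules give
    [g M = M], so that the Leibniz kernel of the hemi-semidirect product is all of [M].

    Weyl's theorem is proved over an arbitrary field of characteristic zero.
    Complements of submodules are found by trivializing cocycles.  By induction
    this reduces to cocycles with values in an irreducible module, on which a
    Casimir element is invertible, because its trace is the rank of the trace
    form.  This needs Cartan's criterion: if [tr (x y) = 0] on a Lie algebra of
    matrices, then its commutators are nilpotent.  The eigenvalues are taken in a
    splitting field; a rational functional [f] on their [Q]-span yields a
    matrix [Y], polynomial in [x], such that [ad Y] is polynomial in [ad x], and
    [tr (x Y) = \sum z f(z)] cannot vanish unless all eigenvalues do. *)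

Require Import Defs.
From HB Require Import structures.
From mathcomp Require Import all_boot all_order all_algebra all_field.
From mathcomp Require Import boolp classical_sets.
From mathcomp Require Import ring zify.
Import Defs.

Set Implicit Arguments.
Unset Strict Implicit.
Unset Printing Implicit Defensive.

Import GRing.Theory.
Local Open Scope classical_set_scope.
Local Open Scope ring_scope.

(** * Splitting fields and triangular matrices *)

(** [Y] behaves like the semisimple part of [x] with each eigenvalue [z] replaced by [f z], but
    nothing is diagonalized: [Y] is [Q(X)], where [Q] is congruent to the constant [f z] modulo a
    high power of ['X - z]. The claim on [ad Y] becomes a congruence between polynomials in two
    commuting variables, the left and right multiplications by [X]; it holds because [f z - f w]
    depends only on [z - w]. Characteristic zero enters twice: the rationals embed in the field, and
    the rank of a nonzero trace form is a nonzero scalar. On the Lie side semisimplicity means the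
    absence of nonzero abelian ideals; every ideal is then perfect. This lets Cartan's criterion and
    the cocycle identity reach whole radicals and kernels, so that representations may be
    non-faithful and trace forms degenerate. *)

Lemma irreducible_dvdp (F : fieldType) (p : {poly F}) :
  (1 < size p)%N -> exists2 q, irreducible_poly q & q %| p.
Proof.
have [d] := ubnP (size p); elim: d p => // d IHd p led p_gt1.
have [[q [q_gt1 q_p q_lt]]|noq] :=
  pselect (exists q : {poly F}, [/\ (1 < size q)%N, q %| p & (size q < size p)%N]).
  have [r irr_r r_q] := IHd q (leq_trans q_lt (ltnSE led)) q_gt1.
  by exists r => //; apply: dvdp_trans q_p.
exists p => //; split=> // q q_neq1 q_p; rewrite -dvdp_size_eqp //.
have p0 : p != 0 by rewrite -size_poly_gt0 ltnW.
have := dvdp_leq p0 q_p; rewrite leq_eqVlt => /orP[//|q_lt].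
have q0 : q != 0 by apply: contraTneq q_p => ->; rewrite dvd0p.
case: noq; exists q; split=> //.
by rewrite ltn_neqAle eq_sym q_neq1 size_poly_gt0.
Qed.

(** One root is adjoined at each step, so the induction ranges over all base fields; only the
    composite embedding is kept. *)
Lemma splitting_field (F : fieldType) (p : {poly F}) : p \is monic ->
  exists (K : fieldType) (iota : {rmorphism F -> K}) (rs : seq K),
    map_poly iota p = \prod_(z <- rs) ('X - z%:P).
Proof.
have [d] := ubnP (size p); elim: d F p => // d IHd F p led mon_p.
have [p_le1|p_gt1] := leqP (size p) 1.
  exists F, idfun, [::]; rewrite big_nil map_poly_id //.
  move: mon_p; rewrite (size1_polyC p_le1) monicE lead_coefC => /eqP->.
  by rewrite polyC1.
have [q irr_q q_p] := irreducible_dvdp p_gt1.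
have [L _ [z qz _]] := irredp_FAdjoin irr_q.
pose j : {rmorphism F -> L} := in_alg L.
have : root (map_poly j p) z.
  by move: qz; rewrite !root_factor_theorem => /dvdp_trans-> //; rewrite dvdp_map.
case/factor_theorem => p2 Dp.
have mon_p2 : p2 \is monic.
  by rewrite -(monicMr _ (monicXsubC z)) -Dp map_monic.
have [|K [i [rs Dp2]]] := IHd L p2 _ mon_p2.
  have := congr1 (fun q : {poly L} => size q) Dp.
  rewrite /= size_map_poly size_monicM ?polyXsubC_eq0 // ?size_XsubC.
  by move=> sz; rewrite sz addn2 in led.
exists K, (i \o j), (i z :: rs).
by rewrite map_poly_comp Dp rmorphM /= Dp2 map_polyXsubC big_cons mulrC.
Qed.

Lemma char_poly_conj (F : fieldType) n (P A : 'M[F]_n) : P \in unitmx ->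
  char_poly (P *m A *m invmx P) = char_poly A.
Proof.
move=> Pu; rewrite /char_poly /char_poly_mx.
have -> : 'X%:M - map_mx polyC (P *m A *m invmx P) =
  map_mx polyC P *m ('X%:M - map_mx polyC A) *m map_mx polyC (invmx P).
  rewrite mulmxBr mulmxBl scalar_mxC -(mulmxA 'X%:M) -!map_mxM /= mulmxV //.
  by rewrite map_mx1 mulmx1.
by rewrite !det_mulmx mulrAC -det_mulmx -map_mxM mulmxV // map_mx1 det1 mul1r.
Qed.

Lemma char_poly_lblock (F : fieldType) m n (A : 'M[F]_m) C (B : 'M_n) :
  char_poly (block_mx A 0 C B) = char_poly A * char_poly B.
Proof.
rewrite /char_poly /char_poly_mx map_block_mx map_mx0 scalar_mx_block.
by rewrite opp_block_mx add_block_mx oppr0 addr0 det_lblock.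
Qed.

(** An eigenvector is completed to a basis and the induction goes on with the remaining diagonal
    block. Matrices act on rows, so the triangular form is the lower one. *)
Lemma trigonalization (F : fieldType) n (A : 'M[F]_n) (rs : seq F) :
    char_poly A = \prod_(z <- rs) ('X - z%:P) ->
  exists2 P, P \in unitmx & is_trig_mx (P *m A *m invmx P).
Proof.
elim: n A rs => [|n IHn] A rs DA.
  by exists 1%:M; rewrite ?unitmx1 // [_ *m A *m _]flatmx0 mx0_is_trig.
case: rs DA => [|a rs] DA.
  by have := size_char_poly A; rewrite DA big_nil size_poly1.
have /eigenvalueP[v vA v0] : eigenvalue A a.
  by rewrite eigenvalue_root_char DA root_prod_XsubC mem_head.
have Pu := row_ebase_unit v; set P := row_ebase v in Pu.
pose u : 'rV[F]_(1 + n) := row_mx 1%:M 0.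
(* The first row of [row_ebase v] is [v] up to the scalar [c], the one-by-one column factor of the
   rank decomposition of [v]. *)
have [c c0 Dv] : exists2 c, c != 0 & v = c *: (u *m P).
  exists (col_ebase v 0 0).
    apply: contraNneq v0 => c0; rewrite -(mulmx_ebase v).
    by rewrite [col_ebase v]mx11_scalar c0 -scalemx1 scale0r !mul0mx.
  rewrite -{1}(mulmx_ebase v) {1}[col_ebase v]mx11_scalar mul_scalar_mx scalemxAl.
  by rewrite rank_rV v0 /u -pid_mx_row.
have uA : u *m P *m A = a *: (u *m P).
  by apply: (scalerI c0); rewrite [LHS]scalemxAl -Dv vA Dv !scalerA mulrC.
pose B : 'M_(1 + n) := P *m A *m invmx P.
have uB : u *m B = a *: u.
  have -> : u *m B = (u *m P *m A) *m invmx P by rewrite /B !mulmxA.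
  by rewrite uA -scalemxAl mulmxK.
have DB : B = block_mx a%:M 0 (dlsubmx B) (drsubmx B).
  rewrite -[LHS]submxK; move: uB; rewrite -{1}[B]submxK mul_row_block.
  rewrite !mul1mx !mul0mx !addr0 scale_row_mx scaler0.
  by case/eq_row_mx=> -> ->; rewrite scale_scalar_mx mulr1.
have [|P' P'u trigP'] := IHn (drsubmx B) rs.
  have : char_poly B = char_poly A by apply: char_poly_conj.
  rewrite {1}DB char_poly_lblock DA big_cons.
  have -> : char_poly (a%:M : 'M[F]_1) = 'X - a%:P.
    by rewrite /char_poly /char_poly_mx det_mx11 !mxE.
  by move/mulfI->; rewrite ?polyXsubC_eq0.
pose R : 'M[F]_(1 + n) := block_mx 1%:M 0 0 P'.
have Ru : R \in unitmx by rewrite unitmxE det_ublock det1 mul1r -unitmxE.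
exists (R *m P); first by rewrite unitmx_mul Ru.
have -> : R *m P *m A *m invmx (R *m P) = R *m B *m invmx R.
  have -> : invmx (R *m P) = invmx P *m invmx R by exact: (invrM Ru Pu).
  by rewrite !mulmxA.
have -> : invmx R = block_mx 1%:M 0 0 (invmx P').
  apply: (can_inj (mulKmx Ru)); rewrite mulmxV //.
  rewrite mulmx_block !mul0mx !mulmx0 !mulmx1 !addr0 !add0r mulmxV //.
  by rewrite -scalar_mx_block.
rewrite DB !mulmx_block !mul0mx !mulmx0 !mulmx1 !mul1mx !addr0 !add0r.
rewrite -[is_trig_mx _]/(@is_trig_mx F (1 + n) (1 + n) _) is_trig_block_mx //.
by rewrite mul0mx eqxx scalar_mx_is_trig.
Qed.

(** * Subspaces and rational functionals *)

Section SubspaceTheory.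
Variables (F : fieldType) (V : lmodType F).
Implicit Types (W A : set V).

Lemma subspaceP W :
  subspace W <-> W 0 /\ forall a u v, W u -> W v -> W (a *: u + v).
Proof.
split=> [[W0 Wl]|[W0 Wl]]; split.
- by move: W0; rewrite inE.
- by move=> a u v Wu Wv; have := Wl a u v; rewrite !inE => /(_ Wu Wv).
- by rewrite inE.
- by move=> a u v; rewrite !inE; apply: Wl.
Qed.

Section Closure.
Variables (W : set V) (sW : subspace W).

Lemma sub0 : W 0. Proof. by have [] := (subspaceP W).1 sW. Qed.

Lemma subD u v : W u -> W v -> W (u + v).
Proof. by move=> Wu Wv; rewrite -[u]scale1r; apply ((subspaceP W).1 sW). Qed.

Lemma subZ a u : W u -> W (a *: u).
Proof.
by move=> Wu; rewrite -[_ *: _]addr0; apply ((subspaceP W).1 sW) => //; exact: sub0.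
Qed.

Lemma subN u : W u -> W (- u).
Proof. by rewrite -scaleN1r; exact: subZ. Qed.

Lemma subB u v : W u -> W v -> W (u - v).
Proof. by move=> Wu Wv; apply: subD => //; apply: subN. Qed.

Lemma sub_sum (I : Type) (r : seq I) (P : pred I) (v : I -> V) :
  (forall i, P i -> W (v i)) -> W (\sum_(i <- r | P i) v i).
Proof. by move=> Wv; elim/big_ind: _ => //; [exact: sub0|exact: subD]. Qed.

End Closure.

Lemma span_subspace A : subspace (span A).
Proof.
apply/subspaceP; split=> [B [sB _]|a u v Au Av B sAB]; first exact: sub0.
by have [sB _] := sAB; apply (subspaceP B).1 => //; [exact: Au|exact: Av].
Qed.

Lemma mem_span A v : A v -> span A v.
Proof. by move=> Av B [_]; exact. Qed.

Lemma span_sub A W : subspace W -> A `<=` W -> span A `<=` W.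
Proof. by move=> sW AW v; apply. Qed.

End SubspaceTheory.

(* A row space of maximal rank among those contained in [W]. *)
Lemma subspace_rowspace (F : fieldType) n (W : set 'rV[F]_n) : subspace W ->
  exists A : 'M_n, forall v, W v <-> (v <= A)%MS.
Proof.
move=> sW; pose P r := `[< exists A : 'M[F]_n,
  \rank A = r /\ forall v : 'rV_n, (v <= A)%MS -> W v >].
have exP : exists r, P r.
  exists 0; apply/asboolP; exists 0; rewrite mxrank0; split=> // v.
  by rewrite submx0 => /eqP->; exact: sub0.
have maxP r : P r -> (r <= n)%N by case/asboolP=> A [<- _]; exact: rank_leq_row.
case: (ex_maxnP exP maxP) => r /asboolP[A [rA WA]] maxr.
exists A => v; split=> [Wv|]; last exact: WA.
suff leA : (\rank (A + v)%MS <= \rank A)%N.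
  by move: leA; rewrite (geq_leqif (mxrank_leqif_sup (addsmxSl A v)))
    addsmx_sub => /andP[].
rewrite rA; apply: maxr; apply/asboolP; exists (A + v)%MS; split=> // w.
case/sub_addsmxP=> -[u1 u2] /= ->; apply: subD => //.
  by apply: WA; exact: submxMl.
by rewrite [u2]mx11_scalar mul_scalar_mx; apply: subZ.
Qed.

Section RationalFunctional.
Variables (K : fieldType) (charK0 : [pchar K] =i pred0).

Lemma char0_intr_eq0 (z : int) : (z%:~R == 0 :> K) = (z == 0).
Proof.
have n0 n : (n%:R == 0 :> K) = (n == 0)%N by rewrite ((pcharf0P K).1 charK0).
by case: z => n; rewrite ?NegzE ?mulrNz ?oppr_eq0 -pmulrn n0.
Qed.

(** Nonzero integers are invertible in [K], so [ratr] can be computed from any fraction and not just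
    the reduced one; its additivity and multiplicativity follow. *)
Lemma char0_ratr_frac (a b : int) : b != 0 ->
  ratr (a%:~R / b%:~R) = a%:~R / b%:~R :> K.
Proof.
move=> b0; set x := a%:~R / b%:~R.
have Dx : numq x * b = a * denq x.
  apply: (@intr_inj rat); rewrite !rmorphM /=.
  by rewrite numqE /x mulrAC divfK // intr_eq0.
apply/eqP; rewrite /ratr eqr_div ?char0_intr_eq0 ?denq_eq0 //.
by rewrite -!rmorphM /= Dx.
Qed.

Lemma char0_ratrD : {morph (ratr : rat -> K) : x y / x + y}.
Proof.
move=> x y; have d0 z : (denq z)%:~R != 0 :> K by rewrite char0_intr_eq0 denq_eq0.
have q0 z : (denq z)%:~R != 0 :> rat by rewrite intr_eq0 denq_eq0.
rewrite -[x in LHS]divq_num_den -[y in LHS]divq_num_den addf_div //.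
rewrite -!rmorphM -rmorphD /= char0_ratr_frac ?mulf_neq0 ?denq_eq0 //.
by rewrite /ratr addf_div // rmorphD !rmorphM.
Qed.

Lemma char0_ratrM : {morph (ratr : rat -> K) : x y / x * y}.
Proof.
move=> x y; rewrite -[x in LHS]divq_num_den -[y in LHS]divq_num_den mulf_div.
rewrite -!rmorphM /= char0_ratr_frac ?mulf_neq0 ?denq_eq0 //.
by rewrite /ratr mulf_div !rmorphM.
Qed.

Lemma char0_ratrB : {morph (ratr : rat -> K) : x y / x - y}.
Proof.
move=> x y; rewrite -mulN1r char0_ratrD char0_ratrM -[-1]/((-1)%:~R) ratr_int.
by rewrite mulrN1z mulN1r.
Qed.

(* [f] is a nonzero vector of [rat^n] orthogonal to the space [R] of rational
   linear relations between the elements of [rs]; if [\sum z * f z] were zero,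
   then [f] would be in [R], hence orthogonal to itself. *)
Lemma rational_functional (rs : seq K) (z0 : K) : z0 \in rs -> z0 != 0 ->
  exists f g : K -> K, {in rs &, forall z w, f z - f w = g (z - w)} /\
    \sum_(z <- rs) z * f z != 0.
Proof.
move=> z0rs z00; pose n := size rs.
pose lam (i : 'I_n) := rs`_i.
pose R : set 'rV[rat]_n := [set c | \sum_i ratr (c 0 i) * lam i = 0].
have sumD a (u v : 'rV_n) : \sum_i ratr ((a *: u + v) 0 i) * lam i =
    ratr a * (\sum_i ratr (u 0 i) * lam i) + \sum_i ratr (v 0 i) * lam i.
  under eq_bigr do rewrite !mxE char0_ratrD char0_ratrM mulrDl -mulrA.
  by rewrite big_split -mulr_sumr.
have sR : subspace R.
  apply/subspaceP; rewrite /R /=; split=> [|a u v Ru Rv].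
    by apply: big1 => i _; rewrite mxE [ratr _](ratr_nat _ 0) mul0r.
  by rewrite sumD Ru Rv mulr0 addr0.
have [A RA] := subspace_rowspace sR.
have ltz0 : (index z0 rs < n)%N by rewrite index_mem.
pose i0 := Ordinal ltz0.
have sum_delta (i : 'I_n) : \sum_j ratr ((delta_mx 0 i : 'rV[rat]_n) 0 j) * lam j = lam i.
  rewrite (bigD1 i) //= big1 ?addr0 => [|j /negPf nj]; rewrite mxE !eqxx /=.
    by rewrite [ratr _](ratr_nat _ 1) mul1r.
  by rewrite nj [ratr _](ratr_nat _ 0) mul0r.
(* [R] is proper because [z0] is nonzero. A column of the cokernel matrix that is nonzero at [i0] is
   a nonzero functional vanishing on [R]. *)
have : ~~ ((delta_mx 0 i0 : 'rV[rat]_n) <= A)%MS.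
  apply/negP => /RA; rewrite /R /= sum_delta /lam /= nth_index //.
  by apply/eqP.
rewrite submxE => /rV0Pn[j A0j]; pose f (i : 'I_n) := cokermx A i j.
have fperp c : R c -> \sum_i c 0 i * f i = 0.
  move/RA; rewrite submxE => /eqP/(congr1 (fun M : 'rV_n => M 0 j)).
  by rewrite !mxE.
have sum_delta_f (i : 'I_n) : \sum_j (delta_mx 0 i : 'rV[rat]_n) 0 j * f j = f i.
  rewrite (bigD1 i) //= big1 ?addr0 => [|k /negPf nk]; rewrite mxE !eqxx /=.
    by rewrite mul1r.
  by rewrite nk mul0r.
have sumDf a (u v : 'rV_n) : \sum_i (a *: u + v) 0 i * f i =
    a * (\sum_i u 0 i * f i) + \sum_i v 0 i * f i.
  under eq_bigr do rewrite !mxE mulrDl -mulrA.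
  by rewrite big_split -mulr_sumr.
have f0 : f i0 != 0 by apply: contraNneq A0j => f0; rewrite mxE sum_delta_f f0.
have frel (i1 i2 i3 i4 : 'I_n) : lam i1 - lam i2 = lam i3 - lam i4 ->
    f i1 - f i2 = f i3 - f i4.
  move=> lamE; pose d i := delta_mx 0 i : 'rV[rat]_n.
  have : R (-1 *: d i2 + (-1 *: d i3 + (1 *: d i1 + d i4))).
    rewrite /R /= !sumD !sum_delta [ratr 1](ratr_nat _ 1).
    rewrite -[-1]/((-1)%:~R) ratr_int mulrN1z !mulN1r mul1r.
    transitivity ((lam i1 - lam i2) - (lam i3 - lam i4)); first by ring.
    by rewrite lamE subrr.
  move/fperp; rewrite !sumDf !sum_delta_f mul1r !mulN1r => H.
  by apply/eqP; rewrite -subr_eq0 -[X in _ == X]H; apply/eqP; ring.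
(* The list may have repetitions: [fK] reads [f] at the first occurrence of [z], a choice made
   immaterial by [frel]; off [rs] the default is 0. *)
pose fK z : K := if insub (index z rs) is Some i then ratr (f i) else 0.
have fKE (i : 'I_n) : fK (lam i) = ratr (f i).
  have lti : (index (lam i) rs < n)%N by rewrite index_mem mem_nth.
  rewrite /fK insubT /=; congr ratr.
  have := frel (Ordinal lti) i i i; rewrite !subrr {1}/lam /= nth_index ?mem_nth //.
  by rewrite subrr => /(_ erefl)/eqP; rewrite subr_eq0 => /eqP.
have mem_lam z : z \in rs -> exists i, z = lam i.
  move=> zrs; have ltz : (index z rs < n)%N by rewrite index_mem.
  by exists (Ordinal ltz); rewrite /lam nth_index.
have /choice[g gE] : forall mu, exists y : K, forall i k, lam i - lam k = mu ->
    y = ratr (f i) - ratr (f k).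
  move=> mu.
  have [[[i k] /= ikmu]|no] := pselect (exists p : 'I_n * 'I_n, lam p.1 - lam p.2 = mu).
    exists (ratr (f i) - ratr (f k)) => i' k' ik'mu.
    have := congr1 (fun q : rat => ratr q : K) (frel i k i' k' (etrans ikmu (esym ik'mu))).
    by rewrite /= !char0_ratrB.
  by exists 0 => i k ikmu; case: no; exists (i, k).
exists fK, g; split=> [z w /mem_lam[i ->] /mem_lam[k ->]|].
  by rewrite !fKE (gE _ i k).
apply: contra f0; rewrite (big_nth 0) big_mkord => /eqP sum0.
have : R (\row_i f i).
  rewrite /R /= -[RHS]sum0; apply: eq_bigr => i _.
  by rewrite mxE mulrC -fKE.
move/fperp; under eq_bigr do rewrite mxE.
move/eqP; rewrite Num.Theory.psumr_eq0 => [/allP/(_ i0)|i _]; last first.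
  by rewrite -expr2 Num.Theory.sqr_ge0.
by rewrite mem_index_enum mulf_eq0 orbb; exact.
Qed.
End RationalFunctional.

(** * Congruences between polynomials *)

Lemma poly_crt (K : fieldType) N (s : seq K) (f : K -> K) : uniq s ->
  exists Q : {poly K}, {in s, forall z, ('X - z%:P) ^+ N %| Q - (f z)%:P}.
Proof.
elim: s => [|z s IHs] /= => [_|/andP[zs /IHs[Q QE]]]; first by exists 0.
pose p := \prod_(w <- s) ('X - w%:P) ^+ N.
have /Bezout_eq1_coprimepP[[u v] /= uv] : coprimep p (('X - z%:P) ^+ N).
  rewrite coprimep_sym /p big_seq; elim/big_ind: _ => [|x y|w ws].
  - exact: coprimep1.
  - by move=> cx cy; rewrite coprimepMr cx cy.
  rewrite coprimep_expl // coprimep_expr // coprimep_XsubC root_XsubC.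
  by apply: contra zs => /eqP E; move: ws; rewrite E.
(* The correction is a multiple of [p], and by the Bezout identity it is congruent to [f z - Q]
   modulo the power of ['X - z]. *)
exists (Q + p * (u * ((f z)%:P - Q))) => w; rewrite inE => /predU1P[->|ws].
  suff -> : Q + p * (u * ((f z)%:P - Q)) - (f z)%:P =
    (v * (Q - (f z)%:P)) * ('X - z%:P) ^+ N by apply: dvdp_mulIr.
  transitivity ((u * p - 1) * ((f z)%:P - Q)); first by ring.
  by rewrite -uv; ring.
rewrite addrAC; apply: dvdp_add; first exact: QE.
by rewrite dvdp_mulr // /p (big_rem w) //= dvdp_mulr.
Qed.

Section PolyIdeal.
Variables (K : fieldType) (A : comNzRingType) (J : A -> Prop).
Hypotheses (J0 : J 0) (JD : forall x y, J x -> J y -> J (x + y))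
  (JM : forall a x, J x -> J (a * x)).

(* The factors [('X - z%:P) ^+ N] are comaximal. *)
Lemma ideal_prod_XsubC (e : {rmorphism {poly K} -> A}) N (s : seq K) (D : A) :
    uniq s ->
    {in s, forall z, exists E, J (D - E * e (('X - z%:P) ^+ N))} ->
    J (e (\prod_(z <- s) ('X - z%:P) ^+ N)) ->
  J D.
Proof.
move=> us JDz Jp.
suff [E JE] : exists E, J (D - E * e (\prod_(z <- s) ('X - z%:P) ^+ N)).
  by rewrite -[D](subrK (E * e (\prod_(z <- s) ('X - z%:P) ^+ N))); auto.
elim: s us JDz {Jp} => [|z s IHs] /= => [_ _|/andP[zs us] JDz].
  by exists D; rewrite big_nil rmorph1 mulr1 subrr.
have [|E1 JE1] := IHs us; first by move=> w ws; apply: JDz; rewrite inE ws orbT.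
have [E2 JE2] := JDz z (mem_head _ _).
rewrite big_cons; set p := \prod_(w <- s) _ in JE1 *; set q := _ ^+ N in JE2 *.
have /Bezout_eq1_coprimepP[[u v] /= uv] : coprimep p q.
  rewrite coprimep_sym /p big_seq; elim/big_ind: _ => [|x y|w ws].
  - exact: coprimep1.
  - by move=> cx cy; rewrite coprimepMr cx cy.
  rewrite coprimep_expl // coprimep_expr // coprimep_XsubC root_XsubC.
  by apply: contra zs => /eqP E; move: ws; rewrite E.
exists (e u * E2 + e v * E1).
have -> : D - (e u * E2 + e v * E1) * e (q * p) =
    e (u * p) * (D - E2 * e q) + e (v * q) * (D - E1 * e p).
  transitivity (e (u * p + v * q) * D - (e u * E2 + e v * E1) * e (q * p)).
    by rewrite uv rmorph1 mul1r.
  by rewrite rmorphD !rmorphM; ring.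
by apply: JD; apply: JM.
Qed.

(** A monomial in [a] and [b] of degree at least [N + N] has an exponent at least [N]; the factors
    [a + b] are expanded one at a time. *)
Lemma ideal_exprD N (a b : A) : J (a ^+ N) -> J (b ^+ N) -> J ((a + b) ^+ (N + N)).
Proof.
move=> Ja Jb; have Jle x n : (N <= n)%N -> J (x ^+ N) -> J (x ^+ n).
  by move=> /subnK <-; rewrite exprD; apply: JM.
suff H k i j : (N + N <= i + j + k)%N -> J (a ^+ i * b ^+ j * (a + b) ^+ k).
  by have := H (N + N)%N 0 0; rewrite !expr0 !mul1r; apply.
elim: k i j => [|k IHk] i j le_ijk.
  rewrite expr0 mulr1; have [leNi|ltiN] := leqP N i.
    by rewrite mulrC; apply: JM; apply: Jle Ja.
  by apply: JM; apply: Jle Jb; lia.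
have -> : a ^+ i * b ^+ j * (a + b) ^+ k.+1 =
  a ^+ i.+1 * b ^+ j * (a + b) ^+ k + a ^+ i * b ^+ j.+1 * (a + b) ^+ k.
  by rewrite !exprS; ring.
by apply: JD; apply: IHk; lia.
Qed.

End PolyIdeal.

Section PolyDifference.
Variables (K : fieldType) (A : comNzRingType) (J : A -> Prop).
Hypotheses (J0 : J 0) (JD : forall x y, J x -> J y -> J (x + y))
  (JM : forall a x, J x -> J (a * x)).
Variables (es et ed : {rmorphism {poly K} -> A}).
Hypotheses (etC : forall c, et c%:P = es c%:P) (edC : forall c, ed c%:P = es c%:P)
  (edX : ed 'X = es 'X - et 'X).

(* [es], [et] and [ed] evaluate polynomials at [s], [t] and [s - t].  Modulo
   [(s - z) ^+ N] and [(t - w) ^+ N] the three terms reduce to the constants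
   [f z], [f w] and [g (z - w)]. *)
Lemma ideal_poly_diff N (s : seq K) (f g : K -> K) (Q P : {poly K}) : uniq s ->
    {in s &, forall z w, f z - f w = g (z - w)} ->
    {in s, forall z, ('X - z%:P) ^+ N %| Q - (f z)%:P} ->
    {in s &, forall z w, ('X - (z - w)%:P) ^+ (N + N) %| P - (g (z - w))%:P} ->
    J (es (\prod_(z <- s) ('X - z%:P) ^+ N)) ->
    J (et (\prod_(z <- s) ('X - z%:P) ^+ N)) ->
  J (es Q - et Q - ed P).
Proof.
move=> us fg QE PE Js Jt; set D := _ - _.
apply: (ideal_prod_XsubC J0 JD JM us _ Jt) => w ws.
(* [J'] is the ideal [J + (q)], and [I] below is [J' + (p)]: modulo [I] both [s - z] and [t - w] are
   nilpotent. *)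
pose q := et (('X - w%:P) ^+ N); pose J' x := exists E, J (x - E * q).
have J'J x : J x -> J' x by move=> Jx; exists 0; rewrite mul0r subr0.
have J'0 : J' 0 by apply: J'J.
have J'D x y : J' x -> J' y -> J' (x + y).
  move=> [E1 JE1] [E2 JE2]; exists (E1 + E2).
  by rewrite (_ : _ - _ = x - E1 * q + (y - E2 * q)); [exact: JD|ring].
have J'M a x : J' x -> J' (a * x).
  move=> [E JE]; exists (a * E).
  by rewrite (_ : _ - _ = a * (x - E * q)); [exact: JM|ring].
suff : J' D by [].
apply: (ideal_prod_XsubC J'0 J'D J'M us _ (J'J _ Js)) => z zs.
pose p := es (('X - z%:P) ^+ N); pose I x := exists E, J' (x - E * p).
have IJ' x : J' x -> I x by move=> Jx; exists 0; rewrite mul0r subr0.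
have ID x y : I x -> I y -> I (x + y).
  move=> [E1 JE1] [E2 JE2]; exists (E1 + E2).
  by rewrite (_ : _ - _ = x - E1 * p + (y - E2 * p)); [exact: J'D|ring].
have IM a x : I x -> I (a * x).
  move=> [E JE]; exists (a * E).
  by rewrite (_ : _ - _ = a * (x - E * p)); [exact: J'M|ring].
have Iz : I ((es ('X - z%:P)) ^+ N).
  by exists 1; rewrite mul1r /p rmorphXn subrr.
have Iw : I ((et ('X - w%:P)) ^+ N).
  by apply/IJ'; exists 1; rewrite mul1r /q rmorphXn subrr.
(* Here [(s - t) - (z - w) = (s - z) - (t - w)] is a sum of two nilpotents of order [N]: this is the
   origin of [N + N]. *)
have Izw : I ((ed ('X - (z - w)%:P)) ^+ (N + N)).
  have -> : ed ('X - (z - w)%:P) = es ('X - z%:P) + - et ('X - w%:P).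
    by rewrite !rmorphB /= ?rmorphB /= etC !edC edX; ring.
  by apply: ideal_exprD => //; rewrite exprNn; apply: IM.
suff : I D by [].
have -> : D = es (Q - (f z)%:P) - et (Q - (f w)%:P) - ed (P - (g (z - w))%:P).
  by rewrite /D -fg // !rmorphB /= ?rmorphB /= etC !edC; ring.
have /dvdpP[q1 ->] := QE z zs; have /dvdpP[q2 ->] := QE w ws.
have /dvdpP[q3 ->] := PE z w zs ws.
rewrite !rmorphM !rmorphXn /= -!mulNr.
exact: (ID _ _ (ID _ _ (IM _ _ Iz) (IM _ _ Iw)) (IM _ _ Izw)).
Qed.

End PolyDifference.

(** * Cartan's criterion *)

(** The comparison takes place in the commutative ring [{poly {poly K}}], with the inner variable
    evaluated at [L] and the outer one at [R]; the ideal [J] is the kernel of this evaluation. *)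
Lemma horner_mx_diff (K : fieldType) n (L R : 'M[K]_n.+1) N (s : seq K)
    (f g : K -> K) (Q P : {poly K}) :
    L *m R = R *m L -> uniq s ->
    {in s &, forall z w, f z - f w = g (z - w)} ->
    {in s, forall z, ('X - z%:P) ^+ N %| Q - (f z)%:P} ->
    {in s &, forall z w, ('X - (z - w)%:P) ^+ (N + N) %| P - (g (z - w))%:P} ->
    horner_mx L (\prod_(z <- s) ('X - z%:P) ^+ N) = 0 ->
    horner_mx R (\prod_(z <- s) ('X - z%:P) ^+ N) = 0 ->
  horner_mx L Q - horner_mx R Q = horner_mx (L - R) P.
Proof.
move=> LR us fg QE PE L0 R0.
have cLR : commr_rmorph (horner_mx L) R.
  move=> p; elim/poly_ind: p => [|p c IHp]; first by rewrite rmorph0; apply: commr0.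
  rewrite rmorphD rmorphM /= horner_mx_X horner_mx_C.
  by apply: commrD; [apply: commrM => //; exact/esym|apply: comm_mx_scalar].
pose phi : {rmorphism {poly {poly K}} -> 'M[K]_n.+1} := horner_morph cLR.
pose es : {rmorphism {poly K} -> {poly {poly K}}} := polyC.
pose et : {rmorphism {poly K} -> {poly {poly K}}} := map_poly polyC.
have cd : commr_rmorph (polyC \o polyC) ('X%:P - 'X : {poly {poly K}}).
  by move=> c; apply: mulrC.
pose ed : {rmorphism {poly K} -> {poly {poly K}}} := horner_morph cd.
have phis q : phi (es q) = horner_mx L q by exact: horner_morphC.
have phit q : phi (et q) = horner_mx R q.
  elim/poly_ind: q => [|q c IHq]; first by rewrite !rmorph0.
  rewrite !rmorphD !rmorphM /= IHq /et map_polyX map_polyC /=.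
  rewrite /phi horner_morphX horner_morphC !horner_mx_C horner_mx_X.
  by congr (_ + _); apply: horner_mx_C.
have phid q : phi (ed q) = horner_mx (L - R) q.
  elim/poly_ind: q => [|q c IHq]; first by rewrite !rmorph0.
  rewrite !rmorphD !rmorphM /= IHq /ed horner_morphX horner_morphC /=.
  rewrite rmorphB /= /phi horner_morphX !horner_morphC horner_mx_X horner_mx_C.
  by congr (_ * (_ - _) + _); [apply: horner_mx_X|apply: horner_mx_C].
have := @ideal_poly_diff K {poly {poly K}} (fun x => phi x = 0) _ _ _ es et ed
  _ _ _ N s f g Q P us fg QE PE.
rewrite phis phit => H; apply/eqP; rewrite -subr_eq0 -phid -phis -phit -!rmorphB.
apply/eqP; apply: H => //.
- exact: rmorph0.
- by move=> x y x0 y0; rewrite rmorphD -[0]addr0; congr (_ + _).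
- by move=> a x x0; rewrite rmorphM -(mulr0 (phi a)); congr (_ * _).
- by move=> c; rewrite /et /= map_polyC.
- by move=> c; rewrite /ed /= horner_morphC.
- by rewrite /ed /et /= horner_morphX map_polyX.
- by rewrite phis.
Qed.

Section TrigHorner.
Variable F : fieldType.

Lemma trig_mulmx n (A B : 'M[F]_n) : is_trig_mx A -> is_trig_mx B ->
  is_trig_mx (A *m B) /\ forall i, (A *m B) i i = A i i * B i i.
Proof.
move=> /is_trig_mxP tA /is_trig_mxP tB; split.
  apply/is_trig_mxP => i j lt_ij; rewrite mxE big1 // => k _.
  have [lt_ik|le_ki] := ltnP i k; first by rewrite tA ?mul0r.
  by rewrite tB ?mulr0 // (leq_ltn_trans le_ki).
move=> i; rewrite mxE (bigD1 i) //= big1 ?addr0 // => k nki.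
have [lt_ik|lt_ki|/val_inj ek] := ltngtP i k; first by rewrite tA ?mul0r.
  by rewrite tB ?mulr0.
by rewrite ek eqxx in nki.
Qed.

Lemma horner_mx_trig n (A : 'M[F]_n.+1) p : is_trig_mx A ->
  is_trig_mx (horner_mx A p) /\ forall i, horner_mx A p i i = p.[A i i].
Proof.
move=> tA; elim/poly_ind: p => [|p c [tp pE]].
  by rewrite rmorph0 mx0_is_trig; split=> // i; rewrite mxE horner0.
rewrite rmorphD rmorphM /= horner_mx_X horner_mx_C.
have [tpA pAE] := trig_mulmx tp tA; split.
  apply/is_trig_mxP => i j lt_ij; rewrite !mxE.
  have /is_trig_mxP/(_ _ _ lt_ij) := tpA; rewrite !mxE => ->.
  by rewrite add0r -[i == j]/(val i == val j) ltn_eqF.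
by move=> i; rewrite mxE [X in X + _](pAE i) pE mxE eqxx !hornerE.
Qed.

(** [ls] is the diagonal of a triangular form of [A], on which polynomials act entrywise. *)
Lemma mxtrace_horner n (A : 'M[F]_n.+1) (rs : seq F) :
    char_poly A = \prod_(z <- rs) ('X - z%:P) ->
  exists ls : seq F, char_poly A = \prod_(z <- ls) ('X - z%:P) /\
  forall p, \tr (horner_mx A p) = \sum_(z <- ls) p.[z].
Proof.
move=> /trigonalization[P Pu tP]; set T := P *m A *m invmx P in tP.
exists [seq T i i | i : 'I_n.+1]; split=> [|q].
  by rewrite -(char_poly_conj A Pu) char_poly_trig // big_map enumT.
rewrite big_map enumT -[in RHS]/T.
have -> : \tr (horner_mx A q) = \tr (horner_mx T q).
  by rewrite horner_mx_uconj // mxtrace_mulC mulKmx.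
by apply: eq_bigr => i _; have [_ ->] := horner_mx_trig q tP.
Qed.

End TrigHorner.

Definition commutator (F : fieldType) n (x y : 'M[F]_n) := x *m y - y *m x.

Lemma trace_form_nilpotent (F : fieldType) (charF0 : [pchar F] =i pred0) m
    (g : set 'M[F]_m.+1) :
    (forall x y, g x -> g y -> g (commutator x y)) ->
    (forall x y, g x -> g y -> \tr (x *m y) = 0) ->
  forall x, g x -> span [set z | exists a b, [/\ g a, g b & z = commutator a b]] x ->
    x ^+ m.+1 = 0.
Proof.
move=> gC gtr x gx comx.
have [K [iota [rs Drs]]] := splitting_field (char_poly_monic x).
have charK0 : [pchar K] =i pred0 by move=> p; rewrite (fmorph_pchar iota) charF0.
pose X := map_mx iota x.
rewrite map_char_poly -/X in Drs.
have [ls [Dls trX]] := mxtrace_horner Drs.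
(* If all eigenvalues vanish, Cayley-Hamilton gives nilpotency over [K], which descends to [F]. *)
have [all0|] := boolP (all (pred1 0) ls).
  have : X ^+ m.+1 = 0.
    have := Cayley_Hamilton X; rewrite Dls => CH.
    have sz : size ls = m.+1.
      by have := size_char_poly X; rewrite Dls size_prod_XsubC => -[].
    have -> : X ^+ m.+1 = horner_mx X (\prod_(z <- ls) ('X - z%:P)).
      rewrite big_seq (eq_bigr (fun=> 'X)) => [|z /(allP all0)/eqP->]; last by rewrite subr0.
      by rewrite -big_seq big_const_seq count_predT sz iter_mulr_1 rmorphXn /= horner_mx_X.
    exact: CH.
  rewrite -rmorphXn /= => /eqP; rewrite map_mx_eq0 => /eqP; exact.
case/allPn=> z0 z0ls /= z00; exfalso.
have [f [g' [fg]]] := rational_functional charK0 z0ls z00.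
apply/negP; rewrite negbK.
pose s := undup ls.
have us : uniq s := undup_uniq ls.
have memS z : (z \in s) = (z \in ls) by rewrite mem_undup.
have fgs : {in s &, forall z w, f z - f w = g' (z - w)}.
  by move=> z w; rewrite !memS; apply: fg.
pose N := m.+1.
(* The exponent [N], being the size of the matrices, bounds all multiplicities, so that the
   characteristic polynomial divides [chi] below. *)
have [Q QE] := poly_crt N f us.
have [P PE] := poly_crt (N + N) g' (undup_uniq [seq z - w | z <- s, w <- s]).
have trXQ : \tr (X *m horner_mx X Q) = \sum_(z <- ls) z * f z.
  have -> : X *m horner_mx X Q = horner_mx X ('X * Q).
    by rewrite rmorphM /= horner_mx_X.
  rewrite trX big_seq [RHS]big_seq; apply: eq_bigr => z zls.
  have /dvdpP[q Dq] : ('X - z%:P) ^+ N %| Q - (f z)%:P by apply: QE; rewrite memS.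
  rewrite hornerM hornerX; congr (_ * _); apply/eqP.
  have : (Q - (f z)%:P).[z] = Q.[z] - f z by rewrite !hornerE.
  rewrite -subr_eq0 => <-; rewrite Dq hornerM horner_exp.
  by rewrite hornerXsubC subrr expr0n mulr0.
rewrite -trXQ {trXQ}.
(* [L] and [R] are the left and right multiplications by [X], so that [L - R] is
   [ad X].  As [Y b - b Y = P (ad X) b], the trace of [[a, b] Y] is the opposite
   of that of [a (P (ad X) b)], which vanishes as [g] is stable under [ad x].
   The dimension [n'.+1] is convertible to [m.+1 * m.+1]. *)
pose n' := (m + m * m.+1)%N.
pose L : 'M[K]_n'.+1 := lin_mx (@mulmx K m.+1 m.+1 m.+1 X).
pose R : 'M[K]_n'.+1 := lin_mx (@mulmxr K m.+1 m.+1 m.+1 X).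
have mxL (Z : 'M[K]_m.+1) : mxvec Z *m L = mxvec (X *m Z).
  exact: (@mul_vec_lin K m.+1 m.+1 m.+1 m.+1 (@mulmx K m.+1 m.+1 m.+1 X) Z).
have mxR (Z : 'M[K]_m.+1) : mxvec Z *m R = mxvec (Z *m X).
  exact: (@mul_vec_lin K m.+1 m.+1 m.+1 m.+1 (@mulmxr K m.+1 m.+1 m.+1 X) Z).
have LE (Z : 'M[K]_m.+1) q : mxvec Z *m horner_mx L q = mxvec (horner_mx X q *m Z).
  elim/poly_ind: q Z => [|q c IHq] Z; first by rewrite !rmorph0 mulmx0 mul0mx linear0.
  rewrite {1}mulrC !rmorphD !rmorphM /= !horner_mx_X !horner_mx_C mulmxDr mulmxDl.
  rewrite linearD mul_mx_scalar mul_scalar_mx linearZ /=; congr (_ + _).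
  by rewrite mulmxA mxL IHq mulmxA.
have RE (Z : 'M[K]_m.+1) q : mxvec Z *m horner_mx R q = mxvec (Z *m horner_mx X q).
  elim/poly_ind: q => [|q c IHq]; first by rewrite !rmorph0 !mulmx0 linear0.
  rewrite !rmorphD !rmorphM /= !horner_mx_X !horner_mx_C !mulmxDr.
  rewrite linearD !mul_mx_scalar linearZ /=; congr (_ + _).
  by rewrite mulmxA IHq mxR mulmxA.
have mxvec_ext (M1 M2 : 'M[K]_n'.+1) :
    (forall Z : 'M[K]_m.+1, mxvec Z *m M1 = mxvec Z *m M2) -> M1 = M2.
  move=> M12; apply/row_matrixP=> i; rewrite !rowE.
  by have := M12 (vec_mx (delta_mx 0 i : 'rV_(m.+1 * m.+1))); rewrite vec_mxK.
pose chi := \prod_(z <- s) ('X - z%:P) ^+ N.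
have chi0 : horner_mx X chi = 0.
  suff /dvdpP[q ->] : char_poly X %| chi by rewrite rmorphM /= Cayley_Hamilton mulr0.
  have sz : size ls = N.
    by have := size_char_poly X; rewrite Dls size_prod_XsubC => -[].
  rewrite Dls -big_undup_iterop_count /chi -/s.
  elim/big_rec2: _ => // z p q _ pq; apply: dvdp_mul => //.
  by rewrite -[iterop _ _ _ _]/(_ ^+ _) dvdp_exp2l // -sz count_size.
have LR : L *m R = R *m L.
  by apply: mxvec_ext => Z; rewrite !mulmxA mxL mxR mxR mxL mulmxA.
have := @horner_mx_diff K n' L R N s f g' Q P LR us fgs QE.
have -> : horner_mx L chi = 0.
  by apply: mxvec_ext => Z; rewrite LE chi0 mul0mx mulmx0 linear0.
have -> : horner_mx R chi = 0.
  by apply: mxvec_ext => Z; rewrite RE chi0 !mulmx0 linear0.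
move=> /(_ _ erefl erefl) DLR.
have {}DLR : horner_mx L Q - horner_mx R Q = horner_mx (L - R) P.
  by apply: DLR => z w zs ws; apply: PE; rewrite mem_undup; apply: allpairs_f.
(* In the induction on [p], a factor [ad X] turns [b] into [[x, b]], which is still in [g] over [F];
   the coefficients in [K] only scale traces that are already zero. *)
have trP (a b : 'M[F]_m.+1) p : g a -> g b ->
    \tr (map_mx iota a *m
      @vec_mx K m.+1 m.+1 (mxvec (map_mx iota b) *m horner_mx (L - R) p)) = 0.
  move=> ga; elim/poly_ind: p b => [|p c IHp] b gb.
    by rewrite rmorph0 mulmx0 linear0 mulmx0 mxtrace0.
  rewrite mulrC rmorphD rmorphM /= horner_mx_X horner_mx_C mulmxDr linearD /=.
  rewrite mulmxDr raddfD /= mul_mx_scalar linearZ /= mxvecK -scalemxAr mxtraceZ.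
  rewrite -map_mxM trace_map_mx gtr // rmorph0 mulr0 addr0.
  have -> : mxvec (map_mx iota b) *m ((L - R) * horner_mx (L - R) p) =
      mxvec (map_mx iota (commutator x b)) *m horner_mx (L - R) p.
    rewrite mulmxA mulmxBr mxL mxR; congr (_ *m _).
    rewrite /commutator map_mxB !map_mxM.
    exact: (esym (@raddfB _ _ (@mxvec K m.+1 m.+1) _ _)).
  by apply: IHp; apply: gC.
pose Y := horner_mx X Q.
(* Having zero trace against [Y] is a linear condition, and [x] is in the span of commutators: it is
   enough to check a single commutator. *)
have sW : subspace [set z : 'M[F]_m.+1 | \tr (map_mx iota z *m Y) = 0].
  apply/subspaceP; split=> /= [|c u v u0 v0]; first by rewrite map_mx0 mul0mx mxtrace0.
  by rewrite map_mxD map_mxZ mulmxDl -scalemxAl mxtraceD mxtraceZ u0 v0 mulr0 addr0.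
apply/eqP; apply: (span_sub sW _ comx) => _ [a [b [ga gb ->]]] /=.
rewrite /commutator map_mxB !map_mxM mulmxBl raddfB /=.
set a' := map_mx iota a; set b' := map_mx iota b.
rewrite -(mulmxA b') (mxtrace_mulC b') -!mulmxA -raddfB -mulmxBr /= {}/a' {}/b'.
have -> : map_mx iota b *m Y - Y *m map_mx iota b =
   - (@vec_mx K m.+1 m.+1 (mxvec (map_mx iota b) *m horner_mx (L - R) P)).
  rewrite -DLR mulmxBr LE RE; apply/esym/(canLR (@opprK _)); rewrite opprB.
  by rewrite -[RHS]mxvecK; congr vec_mx; exact: (esym (@raddfB _ _ (@mxvec K m.+1 m.+1) _ _)).
by rewrite mulmxN raddfN /= trP ?oppr0.
Qed.

(** * Engel's theorem *)

Section Commutator.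
Variables (F : fieldType) (n : nat).
Implicit Types x y z : 'M[F]_n.

Lemma commutatorC x y : commutator x y = - commutator y x.
Proof. by rewrite /commutator opprB. Qed.

Lemma commutatorxx x : commutator x x = 0.
Proof. exact: subrr. Qed.

Lemma commutatorDl x y z : commutator (x + y) z = commutator x z + commutator y z.
Proof. by rewrite /commutator mulmxDl mulmxDr opprD addrACA. Qed.

Lemma commutatorDr x y z : commutator x (y + z) = commutator x y + commutator x z.
Proof. by rewrite /commutator mulmxDl mulmxDr opprD addrACA. Qed.

Lemma commutatorZl c x y : commutator (c *: x) y = c *: commutator x y.
Proof. by rewrite /commutator -scalemxAl -scalemxAr scalerBr. Qed.

Lemma commutatorZr c x y : commutator x (c *: y) = c *: commutator x y.
Proof. by rewrite /commutator -scalemxAl -scalemxAr scalerBr. Qed.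

End Commutator.

Section Engel.
Variables (F : fieldType) (m : nat).
Implicit Types (h : set 'M[F]_m) (v : 'rV[F]_m).

(** These are the vectors killed by all products of [i] elements of [h]. The chain reaches the whole
    space exactly when the associative algebra without unit generated by [h] is nilpotent. *)
Fixpoint ker_chain h i : set 'rV[F]_m :=
  if i is j.+1 then [set v | forall a, h a -> ker_chain h j (v *m a)] else [set 0].

Lemma ker_chain_subspace h i : subspace (ker_chain h i).
Proof.
elim: i => [|i IHi]; apply/subspaceP; split=> //=.
- by move=> a u v -> ->; rewrite scaler0 addr0.
- by move=> a _; rewrite mul0mx; exact: sub0.
- move=> c u v Ku Kv a ha; rewrite mulmxDl -scalemxAl.
  by apply: subD => //; [apply: subZ => //; exact: Ku|exact: Kv].
Qed.

Lemma ker_chainS h i v : ker_chain h i v -> ker_chain h i.+1 v.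
Proof.
elim: i v => [|i IHi] v; first by move=> -> a _; rewrite mul0mx.
by move=> Kv a ha; apply: IHi; apply: Kv.
Qed.

Lemma ker_chain_leq h i j v : (i <= j)%N -> ker_chain h i v -> ker_chain h j v.
Proof.
move=> /subnK <-; elim: (j - i)%N => // k IHk Kv.
by rewrite addSn; apply: ker_chainS; apply: IHk.
Qed.

(* Engel's theorem, in Jacobson's form: a subalgebra [U] whose kernel chain
   exhausts the space is enlarged by an element [y] outside of [U] normalizing
   it; [y] is a last element outside of [U] of a filtration of [g] by the degree
   with which matrices act on the kernel chain of [U]. *)
Lemma engel_chain (g : set 'M[F]_m) :
    subspace g -> (forall x y, g x -> g y -> g (commutator x y)) ->
    (forall x, g x -> exists k, x ^+ k = 0) ->
  exists N, forall v, ker_chain g N v.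
Proof.
move=> sg gC gnil.
pose good (U : {vspace 'M[F]_m}) := [/\ forall x, x \in U -> g x,
  {in U &, forall x y, commutator x y \in U}
  & exists N, forall v, ker_chain [set` U] N v].
have [r /asboolP[U [rU [Ug UC [N UN]]]] maxr] : exists2 r,
    `[< exists U, \dim U = r /\ good U >] &
    forall r', `[< exists U, \dim U = r' /\ good U >] -> (r' <= r)%N.
  have exP : exists r, `[< exists U, \dim U = r /\ good U >].
    exists 0; apply/asboolP; exists 0%VS; rewrite dimv0; split=> //; split.
    - by move=> x; rewrite memv0 => /eqP->; exact: sub0.
    - move=> x y; rewrite !memv0 => /eqP-> /eqP->.
      by rewrite /commutator mul0mx subrr.
    - exists 1%N => v a /=; rewrite memv0 => /eqP->; exact: mulmx0.
  have maxP r : `[< exists U, \dim U = r /\ good U >] ->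
      (r <= \dim {: 'M[F]_m})%N.
    by case/asboolP=> U [<- _]; exact: dimvS (subvf U).
  by case: (ex_maxnP exP maxP) => r; exists r.
pose h := [set` U] : set 'M[F]_m.
have [gU|] := pselect (g `<=` h).
  exists N => v; have := UN v; elim: N {UN} v => // N IHN v Kv a ga.
  by apply: IHN; apply: Kv; apply: gU.
move=> gU; exfalso.
have {gU}[y0 gy0 Uy0] : exists2 y, g y & ~ h y.
  by apply: contra_notP gU => noy y gy; apply: contra_notP noy => Uy; exists y.
(* [A k] asks that [z] lower the chain by [k - N], the shift by [N] keeping indices natural. [A 0]
   holds on all of [g] and [A (N + N)] forces [z = 0], so there is a last [k] with an element
   outside of [h]. *)
pose A k z := g z /\ forall i v, ker_chain h i v -> ker_chain h (i + N - k) (v *m z).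
have [k [y [gy Ay Uy]] maxk] : exists2 k, exists y, [/\ g y, A k y & ~ h y] &
    forall z, A k.+1 z -> h z.
  have [//|nok] := pselect (exists2 k, exists y, [/\ g y, A k y & ~ h y] &
    forall z, A k.+1 z -> h z).
  have Pk k : exists y, [/\ g y, A k y & ~ h y].
    elim: k => [|k IHk].
      exists y0; split=> //; split=> // i v _; rewrite subn0.
      exact: ker_chain_leq (leq_addl _ _) (UN _).
    have [[z [Az Uz]]|noz] := pselect (exists z, A k.+1 z /\ ~ h z).
      by exists z; split=> //; case: Az.
    case: nok; exists k => // z Az.
    by apply: contra_notP noz => Uz; exists z.
  have [y [_ [_ Ay] []]] := Pk (N + N)%N.
  suff -> : y = 0 by rewrite /h /= mem0v.
  apply/row_matrixP=> i; rewrite rowE row0.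
  by have := Ay N _ (UN (delta_mx 0 i)); rewrite subnn.
(* Elements of [U] lower the chain by one, so the commutator is one degree better than [y] and
   maximality of [k] puts it in [U]. *)
have Uay a : a \in U -> commutator a y \in U.
  move=> Ua; apply: maxk; split; first exact: gC (Ug _ Ua) gy.
  move=> [|i] v.
    by move=> -> /=; rewrite mul0mx; apply: sub0; exact: ker_chain_subspace.
  move=> Kv; rewrite /commutator mulmxBr !mulmxA; apply: subB.
  - exact: ker_chain_subspace.
  - have [_ /(_ i (v *m a) (Kv a Ua))] := Ay.
    by apply: ker_chain_leq; lia.
  - have [_ /(_ i.+1 v Kv)] := Ay.
    case e: (i.+1 + N - k)%N => [|p].
      by move=> ->; rewrite mul0mx; apply: sub0; exact: ker_chain_subspace.
    by move/(_ a Ua); apply: ker_chain_leq; lia.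
have Ky i v : ker_chain h i v -> ker_chain h i (v *m y).
  elim: i v => [|i IHi] v; first by move=> -> /=; rewrite mul0mx.
  move=> Kv a Ua; have -> : v *m y *m a = v *m a *m y - v *m commutator a y.
    by rewrite /commutator mulmxBr !mulmxA opprB addrC subrK.
  apply: subB; first exact: ker_chain_subspace.
    by apply: IHi; apply: Kv.
  by apply: Kv; apply: Uay.
have [p yp] := gnil y gy.
pose U' := (U + <[y]>)%VS.
have memU' z : z \in U' -> exists2 a, a \in U & exists c, z = a + c *: y.
  by case/memv_addP=> a Ua [_ /vlineP[c ->] ->]; exists a => //; exists c.
have U'U a : a \in U -> a \in U' by apply/subvP/addvSl.
suff : (\dim U' <= \dim U)%N.
  rewrite (geq_leqif (dimv_leqif_sup (addvSl _ _))) => /subvP U'U'.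
  by apply: Uy; apply: U'U'; apply: (subvP (addvSr _ _)); exact: memv_line.
rewrite rU; apply: maxr; apply/asboolP; exists U'; split=> //; split.
- move=> z /memU'[a Ua [c ->]]; apply: subD => //; first exact: Ug.
  exact: subZ.
- move=> z w /memU'[a Ua [c ->]] /memU'[b Ub [d ->]].
  have -> : commutator (a + c *: y) (b + d *: y) =
      commutator a b + d *: commutator a y - c *: commutator b y.
    rewrite commutatorDl !commutatorDr !commutatorZl !commutatorZr commutatorxx.
    by rewrite !scaler0 addr0 [commutator y b]commutatorC scalerN.
  apply: U'U; apply: memvB; last by apply: memvZ; apply: Uay.
  by apply: memvD; [apply: UC|apply: memvZ; apply: Uay].
exists (p * N)%N => v; have := UN v; elim: N {UN A Ay maxk} v => [|i IHi] v.
  by move=> ->; apply: sub0; exact: ker_chain_subspace.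
(* Descending one level of the chain of [U] takes at most [p] factors from [U'], since [y] preserves
   the levels and [y ^+ p = 0]; hence the length [p * N]. *)
suff step j w : ker_chain h i.+1 w -> ker_chain h i (w *m y ^+ j) ->
    ker_chain [set` U'] (p * i + j) w.
  move=> Kv; rewrite mulnS addnC; apply: step => //.
  by rewrite yp mulmx0; apply: sub0; exact: ker_chain_subspace.
elim: j w => [|j IHj] w Kw; first by rewrite expr0 mulmx1 addn0; exact: IHi.
rewrite exprS mulmxA => Kwy; rewrite addnS => z /memU'[a Ua [c ->]].
rewrite mulmxDr -scalemxAr; apply: subD; first exact: ker_chain_subspace.
  by apply: (ker_chain_leq (leq_addr _ _)); apply: IHi; apply: Kw.
apply: subZ; first exact: ker_chain_subspace.
by apply: IHj => //; exact: Ky.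
Qed.

(** As long as some [x] moves [v] to a nonzero vector, that vector is again in [U] and one level
    lower in the kernel chain; the descent stops before level 0, which contains only 0. *)
Lemma engel (g : set 'M[F]_m) (U : set 'rV[F]_m) :
    subspace g -> (forall x y, g x -> g y -> g (commutator x y)) ->
    (forall x, g x -> exists k, x ^+ k = 0) ->
    (forall v x, U v -> g x -> U (v *m x)) ->
    (exists2 v, U v & v != 0) ->
  exists v, [/\ U v, v != 0 & forall x, g x -> v *m x = 0].
Proof.
move=> sg gC gnil Ug [v Uv v0]; have [N gN] := engel_chain sg gC gnil.
have := gN v; elim: N {gN} v Uv v0 => [|N IHN] v Uv v0; first by move/eqP; rewrite (negPf v0).
move=> Kv; have [[x gx vx]|no] := pselect (exists2 x, g x & v *m x != 0).
  by apply: IHN (vx) _; [exact: Ug|exact: Kv].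
exists v; split=> // x gx; apply/eqP; apply: contra_notT no => vx; by exists x.
Qed.
End Engel.

(** * Weyl's theorem *)

Lemma linear_fun0 (F : fieldType) (U V : lmodType F) (f : U -> V) :
  linear f -> f 0 = 0.
Proof. by move=> /(_ (-1) 0 0); rewrite scaler0 addr0 scaleN1r addNr. Qed.

Lemma linear_funN (F : fieldType) (U V : lmodType F) (f : U -> V) (lf : linear f) u :
  f (- u) = - f u.
Proof.
by have := lf (-1) u 0; rewrite !addr0 !scaleN1r (linear_fun0 lf) addr0.
Qed.

Lemma linear_funD (F : fieldType) (U V : lmodType F) (f : U -> V) (lf : linear f) u v :
  f (u + v) = f u + f v.
Proof. by have := lf 1 u v; rewrite !scale1r. Qed.

Lemma linear_funZ (F : fieldType) (U V : lmodType F) (f : U -> V) (lf : linear f) c u :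
  f (c *: u) = c *: f u.
Proof. by have := lf c u 0; rewrite !addr0 (linear_fun0 lf) addr0. Qed.

Lemma linear_fun_sum (F : fieldType) (U V : lmodType F) (f : U -> V) (lf : linear f)
    (I : Type) (r : seq I) (P : pred I) (u : I -> U) :
  f (\sum_(i <- r | P i) u i) = \sum_(i <- r | P i) f (u i).
Proof.
elim/big_rec2: _ => [|i x y _ <-]; first exact: linear_fun0.
exact: linear_funD.
Qed.

Lemma linear_mxP (F : fieldType) m n (f : 'rV[F]_m -> 'rV[F]_n) : linear f ->
  exists A : 'M_(m, n), forall u, u *m A = f u.
Proof.
move=> lin_f; pose lf := GRing.isLinear.Build _ _ _ _ f lin_f.
pose fL : {linear 'rV[F]_m -> 'rV[F]_n} := HB.pack f lf.
by exists (lin1_mx fL) => u; rewrite mul_rV_lin1.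
Qed.

Lemma bilinear_form_mx (F : fieldType) m n (beta : 'rV[F]_m -> 'rV[F]_n -> F) :
    (forall y, scalar (beta^~ y)) -> (forall x, scalar (beta x)) ->
  exists B : 'M_(m, n), forall x y, beta x y = (x *m B *m y^T) 0 0.
Proof.
move=> betal betar; exists (\matrix_(i, j) beta (delta_mx 0 i) (delta_mx 0 j)) => x y.
have sumP k (f : 'rV[F]_k -> F) u : scalar f -> f u = \sum_i u 0 i * f (delta_mx 0 i).
  move=> lin_f; pose lf := GRing.isLinear.Build _ _ _ _ f lin_f.
  pose fL : {scalar 'rV[F]_k} := HB.pack f lf.
  rewrite -[LHS]/(fL u) {1}[u]row_sum_delta linear_sum.
  by apply: eq_bigr => i _; rewrite linearZ.
rewrite (sumP _ (beta x)) // mxE; apply: eq_bigr => j _.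
rewrite (sumP _ (beta^~ _)) // mulrC !mxE; congr (_ * _).
by apply: eq_bigr => i _; rewrite mxE.
Qed.

(** The Gram matrix of [beta] on a basis [E] of [W] is invertible, which gives a formula for the
    orthogonal projection onto [W]. *)
Lemma orthogonal_decomposition (F : fieldType) n (beta : 'rV[F]_n -> 'rV[F]_n -> F)
    (W : set 'rV[F]_n) :
    (forall y, scalar (beta^~ y)) -> (forall x, scalar (beta x)) -> subspace W ->
    (forall x, W x -> (forall y, W y -> beta x y = 0) -> x = 0) ->
  forall x, exists2 u, W u & forall y, W y -> beta (x - u) y = 0.
Proof.
move=> betal betar /subspace_rowspace[A WA] Wnd x.
have [B betaE] := bilinear_form_mx betal betar.
pose E := row_base A; have WE v : W v <-> (v <= E)%MS by rewrite WA eq_row_base.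
pose G := E *m B *m E^T.
have Gu : G \in unitmx.
  rewrite -row_free_unit; apply: inj_row_free => w wG.
  suff wE : w *m E = 0.
    by rewrite -[w](mulmxKp (row_base_free A)) wE mul0mx.
  apply: Wnd => [|y]; first by apply/WE; exact: submxMl.
  move=> /WE/submxP[v ->]; rewrite betaE (trmx_mul v).
  have -> : w *m E *m B *m (E^T *m v^T) = w *m G *m v^T by rewrite /G !mulmxA.
  by rewrite wG mul0mx mxE.
exists (x *m B *m E^T *m invmx G *m E); first by apply/WE; exact: submxMl.
move=> y /WE/submxP[v ->]; rewrite betaE (trmx_mul v) !mulmxBl.
have -> : x *m B *m E^T *m invmx G *m E *m B *m (E^T *m v^T) =
    x *m B *m E^T *m (invmx G *m G) *m v^T by rewrite /G !mulmxA.
rewrite mulVmx // mulmx1 mulmxA.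
by rewrite subrr mxE.
Qed.

Lemma linear_mxvecP (F : fieldType) m n (f : 'M[F]_(m, n) -> 'M[F]_(m, n)) :
  linear f -> exists A, forall M, mxvec M *m A = mxvec (f M).
Proof.
move=> lin_f; have [|A AE] := @linear_mxP F _ _ (fun u => mxvec (f (vec_mx u))).
  by move=> c u v; rewrite linearP lin_f linearP.
by exists A => M; rewrite AE mxvecK.
Qed.

(** Coordinates for a subspace and its quotient: [a] is the inclusion and [a'] a retraction of it,
    [q] is the projection to the quotient and [s] a section of it. *)
Lemma split_row_space (F : fieldType) m (U : 'M[F]_m) :
  exists r r' (a : 'M[F]_(r, m)) (s : 'M[F]_(r', m)) a' q,
    [/\ r = \rank U, (r + r')%N = m & (a :=: U)%MS] /\
    [/\ a *m a' = 1%:M, a *m q = 0, s *m a' = 0, s *m q = 1%:M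
      & a' *m a + q *m s = 1%:M].
Proof.
pose a := row_base U; pose s := row_base U^C%MS; pose P := col_mx a s.
have rr' : (\rank U + \rank U^C)%N = m by rewrite mxrank_compl subnKC ?rank_leq_row.
have Pfull : row_full P.
  rewrite -sub1mx -addsmxE (adds_eqmx (eq_row_base U) (eq_row_base U^C%MS)).
  by rewrite sub1mx addsmx_compl_full.
have Pfree : row_free P by rewrite /row_free (eqP Pfull) rr'.
exists _, _, a, s, (lsubmx (pinvmx P)), (rsubmx (pinvmx P)); split.
  by split=> //; exact: eq_row_base.
have := mulmxVp Pfree; rewrite -{1}[pinvmx P]hsubmxK mul_col_row scalar_mx_block.
case/eq_block_mx=> -> -> -> ->; split=> //.
by rewrite -mul_row_col hsubmxK; exact: mulVpmx.
Qed.

(** * Lie algebras in coordinates, with the Jacobi identity in right-module form *)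

Section LieAlgebra.
Variables (F : fieldType) (charF0 : [pchar F] =i pred0) (n : nat).
Local Notation g := 'rV[F]_n.
Variable br : g -> g -> g.
Hypotheses (brDl : forall y, linear (br^~ y)) (brDr : forall x, linear (br x)).
Hypotheses (brxx : forall x, br x x = 0).
Hypotheses (jacobi : forall x y z, br x (br y z) = br (br x y) z - br (br x z) y).

Lemma brC x y : br x y = - br y x.
Proof.
apply/eqP; rewrite -addr_eq0; have := brxx (x + y).
have D a b c : br (a + b) c = br a c + br b c by have := brDl c 1 a b; rewrite !scale1r.
have D' a b c : br c (a + b) = br c a + br c b by have := brDr c 1 a b; rewrite !scale1r.
by rewrite D !D' !brxx add0r addr0 => ->.
Qed.

Definition lie_ideal (I : set g) := subspace I /\ forall x u, I x -> I (br x u).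

Lemma lie_idealr I u x : lie_ideal I -> I x -> I (br u x).
Proof. by move=> [sI HI] Ix; rewrite brC; apply: subN => //; apply: HI. Qed.

Definition derived_ideal (I : set g) :=
  span [set z | exists a b, [/\ I a, I b & z = br a b]].

Lemma derived_ideal_ideal I : lie_ideal I -> lie_ideal (derived_ideal I).
Proof.
move=> [sI HI]; split=> [|x u]; first exact: span_subspace.
pose W : set g := [set x | derived_ideal I (br x u)].
suff : derived_ideal I `<=` W by apply.
apply: span_sub.
  apply/subspaceP; split; rewrite /W /=.
    by rewrite (linear_fun0 (brDl u)); apply: (sub0 (span_subspace _)).
  move=> a v w dv dw; rewrite brDl; apply: (subD (span_subspace _)) => //.
  exact: (subZ (span_subspace _)).
move=> _ [a [b [Ia Ib ->]]]; rewrite /W /=.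
have -> : br (br a b) u = br (br a u) b + br a (br b u).
  by rewrite jacobi addrC subrK.
apply: (subD (span_subspace _)); apply: mem_span.
  by exists (br a u), b; split=> //; apply: HI.
by exists a, (br b u); split=> //; apply: HI.
Qed.

Lemma derived_ideal_sub I : lie_ideal I -> derived_ideal I `<=` I.
Proof. by move=> [sI HI]; apply: span_sub => // _ [a [b [Ia Ib ->]]]; apply: HI. Qed.

(* Modules are right modules, as matrices act on row vectors: a left module is
   turned into a right one by [v . x := - x . v]. *)
Section Representation.
Variables (m : nat) (rho : g -> 'M[F]_m).
Hypotheses (rhoL : linear rho)
  (rhoM : forall x y, rho (br x y) = commutator (rho x) (rho y)).

Definition trace_form x y := \tr (rho x *m rho y).

Lemma trace_formC x y : trace_form x y = trace_form y x.
Proof. exact: mxtrace_mulC. Qed.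

Lemma trace_forml y : scalar (trace_form^~ y).
Proof.
by move=> c u v; rewrite /trace_form rhoL mulmxDl -scalemxAl mxtraceD mxtraceZ.
Qed.

Lemma trace_formr x : scalar (trace_form x).
Proof. by move=> c u v; rewrite trace_formC trace_forml !(trace_formC x). Qed.

Lemma trace_form_inv x u y : trace_form (br x u) y = trace_form x (br u y).
Proof.
rewrite /trace_form !rhoM /commutator mulmxBl mulmxBr !raddfB /= !mulmxA.
by congr (_ - _); rewrite -[in LHS]mulmxA mxtrace_mulC.
Qed.

Lemma rho_image_subspace I : subspace I -> subspace (rho @` I).
Proof.
move=> sI; apply/subspaceP; split.
  by exists 0; [exact: sub0|exact: linear_fun0].
move=> a _ _ [u Iu <-] [v Iv <-]; exists (a *: u + v); last exact: rhoL.
by apply: subD => //; apply: subZ.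
Qed.

Lemma rho_image_commutator I : lie_ideal I -> forall x y,
  (rho @` I) x -> (rho @` I) y -> (rho @` I) (commutator x y).
Proof.
move=> [sI HI] _ _ [x Ix <-] [y Iy <-]; exists (br x y); last exact: rhoM.
exact: HI.
Qed.

Lemma derived_ideal_nilpotent I : lie_ideal I ->
    (forall x y, I x -> I y -> trace_form x y = 0) ->
  forall x, derived_ideal I x -> exists k, rho x ^+ k = 0.
Proof.
move=> idI; rewrite /trace_form => I0 x dx; case: m rho rhoL rhoM I0 => [|m'] r rL rM I0.
  by exists 0%N; apply/matrixP; case.
exists m'.+1; apply: (@trace_form_nilpotent _ charF0 m' (r @` I)).
- move=> _ _ [a Ia <-] [b Ib <-]; exists (br a b); last exact: rM.
  by apply idI.
- by move=> _ _ [a Ia <-] [b Ib <-]; apply: I0.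
- by exists x => //; apply: derived_ideal_sub.
pose W : set g := [set x | span [set z | exists a b,
  [/\ (r @` I) a, (r @` I) b & z = commutator a b]] (r x)].
suff : derived_ideal I `<=` W by apply.
apply: span_sub.
  apply/subspaceP; split; rewrite /W /=.
    by rewrite (linear_fun0 rL); apply: (sub0 (span_subspace _)).
  move=> a v w dv dw; rewrite rL; apply: (subD (span_subspace _)) => //.
  exact: (subZ (span_subspace _)).
move=> _ [a [b [Ia Ib ->]]]; rewrite /W /= rM; apply: mem_span.
by exists (r a), (r b); split=> //; [exists a|exists b].
Qed.

Lemma nilpotent_ideal_kernel I (U : set 'rV[F]_m) : lie_ideal I ->
    (forall x, I x -> exists k, rho x ^+ k = 0) ->
    (forall v x, U v -> I x -> U (v *m rho x)) -> (exists2 v, U v & v != 0) ->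
  exists v, [/\ U v, v != 0 & forall x, I x -> v *m rho x = 0].
Proof.
move=> idI Inil UI exU; have [sI _] := idI.
have [|||v [Uv v0 vI]] := @engel _ _ (rho @` I) U (rho_image_subspace sI) _ _ _ exU.
- exact: rho_image_commutator.
- by move=> _ [x Ix <-]; apply: Inil.
- by move=> v _ Uv [x Ix <-]; apply: UI.
by exists v; split=> // x Ix; apply: vI; exists x.
Qed.

End Representation.

Lemma row_mul_inj k (A B : 'M[F]_(n, k)) : (forall u : g, u *m A = u *m B) -> A = B.
Proof. by move=> AB; apply/row_matrixP=> i; rewrite !rowE. Qed.

Lemma adjoint_rep : exists ad : g -> 'M[F]_n,
  [/\ linear ad, forall x y, ad (br x y) = commutator (ad x) (ad y)
    & forall u x, u *m ad x = br u x].
Proof.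
have /choice[ad adE] : forall x, exists A : 'M[F]_n, forall u, u *m A = br u x.
  by move=> x; apply: linear_mxP.
exists ad; split=> // [a x y|x y]; apply: row_mul_inj => u.
  by rewrite mulmxDr -scalemxAr !adE brDr.
by rewrite mulmxBr !mulmxA !adE jacobi.
Qed.

Section Semisimple.
Hypothesis semisimple_br : forall I, lie_ideal I ->
  (forall x y, I x -> I y -> br x y = 0) -> forall x, I x -> x = 0.

(** By Cartan's criterion [[I, I]] acts nilpotently. Were it nonzero, Engel's theorem would give it
    a nonzero centre, which is an abelian ideal of the whole algebra. So [I] is abelian, hence
    zero. *)
Lemma ideal_form0 I (ad : g -> 'M[F]_n) : linear ad ->
    (forall x y, ad (br x y) = commutator (ad x) (ad y)) ->
    (forall u x, u *m ad x = br u x) -> lie_ideal I ->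
    (forall x y, I x -> I y -> trace_form ad x y = 0) ->
  forall x, I x -> x = 0.
Proof.
move=> adL adM adE idI I0; apply: semisimple_br => // x y Ix Iy.
suff D0 z : derived_ideal I z -> z = 0 by apply: D0; apply: mem_span; exists x, y.
move=> Dz; apply/eqP; apply: contra_notT (id : ~ False) => z0.
have idD := derived_ideal_ideal idI; have [sD HD] := idD.
have [||v [Dv v0 vD]] := nilpotent_ideal_kernel adL adM idD
    (derived_ideal_nilpotent adL adM idI I0) (U := derived_ideal I).
- by move=> v w Dv Dw; rewrite adE; apply: HD.
- by exists z.
move: v0; apply/negP; rewrite negbK; apply/eqP.
apply: (semisimple_br (I := [set v | derived_ideal I v /\
    forall x, derived_ideal I x -> br v x = 0])).
- split=> [|w u [Dw wD]].
    apply/subspaceP; split=> [|a u w [Du uD] [Dw wD]].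
      by split=> [|w _]; [exact: sub0|exact: (linear_fun0 (brDl w))].
    split=> [|t Dt]; first by apply: (subD sD) => //; apply: (subZ sD).
    by rewrite brDl uD // wD // scaler0 addr0.
  split=> [|t Dt]; first exact: HD.
  have -> : br (br w u) t = br (br w t) u + br w (br u t) by rewrite jacobi addrC subrK.
  by rewrite wD // (linear_fun0 (brDl u)) add0r wD //; apply: (lie_idealr _ idD).
- by move=> a b [_ aD] [Db _]; exact: aD.
by split=> // w Dw; rewrite -adE vD.
Qed.

(** By [ideal_form0] the Killing form is nondegenerate on [D = [I, I]], so [I] is the sum of [D] and
    its intersection with [perp]. The latter is abelian, its brackets being both in [D] and
    orthogonal to [D], hence zero. *)
Lemma ideal_perfect I : lie_ideal I -> I `<=` derived_ideal I.
Proof.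
move=> idI x Ix; have [ad [adL adM adE]] := adjoint_rep.
pose D := derived_ideal I; have idD : lie_ideal D := derived_ideal_ideal idI.
have [sI HI] := idI; have [sD HD] := idD.
pose perp := [set u | forall y, D y -> trace_form ad u y = 0].
have perpI J : lie_ideal J -> lie_ideal (J `&` perp).
  move=> [sJ HJ]; split=> [|u w [Ju pu]].
    apply/subspaceP; split=> [|a u w [Ju pu] [Jw pw]].
      split=> [|y _]; first exact: sub0.
      by rewrite /trace_form (linear_fun0 adL) mul0mx mxtrace0.
    split=> [|y Dy]; first by apply: (subD sJ) => //; apply: (subZ sJ).
    by rewrite (trace_forml adL) pu // pw // mulr0 addr0.
  split=> [|y Dy]; first exact: HJ.
  by rewrite (trace_form_inv adM) pu //; apply: (lie_idealr _ idD).
have Dperp0 w : D w -> (forall y, D y -> trace_form ad w y = 0) -> w = 0.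
  move=> Dw pw; apply: (ideal_form0 adL adM adE (perpI D idD)) => //.
  by move=> u v [_ pu] [Dv _]; apply: pu.
have [u Du pu] := orthogonal_decomposition (trace_forml adL) (trace_formr adL) sD Dperp0 x.
suff /eqP : x - u = 0 by rewrite subr_eq0 => /eqP->.
apply: (semisimple_br (perpI I idI)).
  move=> a b [Ia pa] [Ib pb]; apply: Dperp0.
    by apply: mem_span; exists a, b.
  by have [_ /(_ a b)[]] := perpI I idI.
by split=> //; apply: (subB sI) => //; apply: (derived_ideal_sub idI).
Qed.


Lemma mxtrace_pid r : (r <= n)%N -> \tr (pid_mx r : 'M[F]_n) = r%:R.
Proof.
move=> le_rn; rewrite /mxtrace -(subnKC le_rn) big_split_ord /= -[RHS]addr0.
congr (_ + _).
  by rewrite (eq_bigr (fun=> 1)) ?sumr_const ?card_ord // => i _; rewrite mxE eqxx /= ltn_ord.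
by apply: big1 => i _; rewrite mxE eqxx /= ltnNge leq_addr.
Qed.

(** * Casimir elements of a possibly degenerate trace form *)

Section Casimir.
Variables (m : nat) (rho : g -> 'M[F]_m).
Hypotheses (rhoL : linear rho)
  (rhoM : forall x y, rho (br x y) = commutator (rho x) (rho y)).
Variables (B : 'M[F]_n) (B_rho : forall x y, trace_form rho x y = (x *m B *m y^T) 0 0).

(** A generalized inverse of the Gram matrix [B], which may be singular. It plays the part of the
    dual basis in the usual Casimir element, with [gram_invK] in place of invertibility. *)
Definition gram_inv : 'M[F]_n :=
  invmx (row_ebase B) *m pid_mx (\rank B) *m invmx (col_ebase B).
Local Notation D := gram_inv.
Local Notation e i := (delta_mx 0 i : g).

Lemma gram_invK : B *m D *m B = B.
Proof.
pose P0 : 'M[F]_n := pid_mx (\rank B).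
have pidK : P0 *m P0 = P0.
  by rewrite /P0 mul_pid_mx minnn (minn_idPr (rank_leq_row B)).
rewrite /gram_inv -/P0; move: (mulmx_ebase B) (row_ebase_unit B) (col_ebase_unit B) pidK.
rewrite -/P0; move: (col_ebase B) (row_ebase B) P0 => L U P <- Uu Lu PP.
by rewrite !mulmxA mulmxK // mulmxKV // -!(mulmxA L) !PP.
Qed.

Lemma gram_sym : B^T = B.
Proof.
apply/matrixP=> i j.
have E k l : B k l = trace_form rho (e k) (e l).
  by rewrite B_rho -rowE trmx_delta -colE !mxE.
by rewrite mxE !E trace_formC.
Qed.

Lemma gram_ad z (A : 'M[F]_n) : (forall u, u *m A = br u z) -> A *m B = - (B *m A^T).
Proof.
move=> AE; apply/matrixP=> i j; rewrite [RHS]mxE.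
have E M k l : (M : 'M[F]_n) k l = (e k *m M *m (e l)^T) 0 0.
  by rewrite -rowE trmx_delta -colE !mxE.
rewrite (E (A *m B)) (E (B *m A^T)) !mulmxA AE -B_rho -(mulmxA (e i *m B)) -trmx_mul AE.
rewrite -B_rho trace_form_inv // brC.
by rewrite /trace_form (linear_funN rhoL) mulmxN raddfN.
Qed.

(* Invariance of the Casimir tensor [\sum_(i, j) D i j (e i) (x) (e j)], up to the
   radical of the trace form, which [S] is required to kill. *)
Lemma casimir_invariant p q (S : g -> g -> 'M[F]_(p, q)) z :
    (forall y, linear (S^~ y)) -> (forall x, linear (S x)) ->
    (forall u y, u *m B = 0 -> S u y = 0) -> (forall u x, u *m B = 0 -> S x u = 0) ->
  \sum_i \sum_j D i j *: (S (br (e i) z) (e j) + S (e i) (br (e j) z)) = 0.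
Proof.
move=> Sl Sr SBl SBr; apply/matrixP=> a b; rewrite [RHS]mxE.
have [A AE] := linear_mxP (brDl z).
have [||M ME] := @bilinear_form_mx F n n (fun x y => S x y a b).
- by move=> y c u v; rewrite Sl !mxE.
- by move=> x c u v; rewrite Sr !mxE.
have E (N : 'M[F]_n) k l : (e k *m N *m (e l)^T) 0 0 = N k l.
  by rewrite -rowE trmx_delta -colE !mxE.
have E' (w : g) k : (w *m (e k)^T) 0 0 = w 0 k by rewrite trmx_delta -colE mxE.
have leftB (N : 'M[F]_n) : (forall u : g, u *m B = 0 -> u *m N = 0) -> N = B *m D *m N.
  move=> BN; apply/eqP; rewrite -subr_eq0 -{1}[N]mul1mx -mulmxBl; apply/eqP.
  apply: row_mul_inj => u; rewrite mulmx0 mulmxA; apply: BN.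
  by rewrite -mulmxA mulmxBl mul1mx gram_invK subrr mulmx0.
(* [S] kills the radical in both arguments, so its matrix [M] factors through [B] on both sides. *)
have MB : M = B *m (D *m M *m D^T) *m B.
  have DM : M = B *m D *m M.
    apply: leftB => u uB; apply/rowP=> k; rewrite [RHS]mxE.
    by rewrite -E' -ME SBl // mxE.
  have DMT : M^T = B *m D *m M^T.
    apply: leftB => u uB; apply/rowP=> k; rewrite [RHS]mxE -E'.
    have -> : u *m M^T *m (e k)^T = (e k *m M *m u^T)^T by rewrite !trmx_mul trmxK mulmxA.
    by rewrite mxE -ME SBr // mxE.
  rewrite {1}DM -[M in LHS]trmxK DMT !trmx_mul trmxK gram_sym.
  by rewrite !mulmxA.
move: (D *m M *m D^T) MB => X MB.
have BAT := gram_ad AE.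
rewrite summxE.
transitivity (\sum_i \sum_j D i j * (A *m M + M *m A^T) i j).
  apply: eq_bigr => i _; rewrite summxE; apply: eq_bigr => j _.
  rewrite !mxE !ME; congr (_ * (_ + _)).
    by rewrite -AE -(mulmxA (e i)) E mxE.
  by rewrite -AE trmx_mul mulmxA -(mulmxA (e i)) E mxE.
transitivity (\tr (D *m (A *m M + M *m A^T)^T)).
  apply: eq_bigr => i _; rewrite [RHS]mxE; apply: eq_bigr => j _.
  by congr (_ * _); rewrite [RHS]mxE.
rewrite linearD /= !trmx_mul trmxK {}MB !trmx_mul gram_sym mulmxDr raddfD /=.
set X' := X^T.
(* The two traces are opposite, because [A *m B = - (B *m A^T)] (invariance of the form) and
   [B *m D *m B = B]. *)
have -> : \tr (D *m (B *m (X' *m B) *m A^T)) = \tr (B *m A^T *m X').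
  have -> : D *m (B *m (X' *m B) *m A^T) = (D *m B *m X') *m (B *m A^T).
    by rewrite !mulmxA.
  rewrite mxtrace_mulC -[B *m A^T]opprK -BAT !mulNmx !raddfN /=; congr (- \tr _).
  by rewrite -[in RHS]gram_invK !mulmxA.
have -> : \tr (D *m (A *m (B *m (X' *m B)))) = - \tr (B *m A^T *m X').
  rewrite mxtrace_mulC.
  have -> : A *m (B *m (X' *m B)) *m D = A *m B *m X' *m (B *m D) by rewrite !mulmxA.
  rewrite BAT mulNmx mulNmx raddfN /=; congr (- _).
  rewrite mxtrace_mulC mulmxA (mulmxA (B *m D) B) gram_invK.
  by [].
by rewrite subrr.
Qed.

Definition casimir p (tau : g -> 'M[F]_(p, m)) : 'M_(p, m) :=
  \sum_i \sum_j D i j *: (tau (e i) *m rho (e j)).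

(* Both a cocycle and [rho] itself can be taken for [tau]. *)
Lemma casimir_cocycle p (tau : g -> 'M[F]_(p, m)) z :
    linear tau ->
    (forall x y, tau (br x y) = tau x *m rho y - tau y *m rho x) ->
    (forall u, u *m B = 0 -> rho u = 0) -> (forall u, u *m B = 0 -> tau u = 0) ->
  casimir tau *m rho z = tau z *m casimir rho.
Proof.
move=> tauL tauM Brho Btau; apply/eqP; rewrite -subr_eq0; apply/eqP.
(* Invariance is applied to [tau x *m rho y]; once [tau] and [rho] are expanded on brackets, the
   terms with [rho z] in the middle cancel. *)
have H : \sum_i \sum_j D i j *: (tau (br (e i) z) *m rho (e j) +
    tau (e i) *m rho (br (e j) z)) = 0.
  apply: (@casimir_invariant p m (fun x y => tau x *m rho y)).
  - by move=> y c u v; rewrite tauL mulmxDl -scalemxAl.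
  - by move=> x c u v; rewrite rhoL mulmxDr -scalemxAr.
  - by move=> u y /Btau->; rewrite mul0mx.
  - by move=> u x /Brho->; rewrite mulmx0.
rewrite -[RHS]H /casimir mulmx_suml mulmx_sumr -sumrB.
apply: eq_bigr => i _; rewrite mulmx_suml mulmx_sumr -sumrB.
apply: eq_bigr => j _; rewrite -scalemxAl -scalemxAr -scalerBr; congr (_ *: _).
rewrite tauM rhoM /commutator mulmxBl mulmxBr !mulmxA [RHS]addrC [RHS]addrA.
by rewrite subrK.
Qed.

(** This trace is that of [D *m B], which is conjugate to [pid_mx (\rank B)]. *)
Lemma mxtrace_casimir : \tr (casimir rho) = (\rank B)%:R.
Proof.
transitivity (\tr (D *m B)).
  rewrite raddf_sum /=; apply: eq_bigr => i _; rewrite raddf_sum [RHS]mxE /=.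
  apply: eq_bigr => j _; rewrite mxtraceZ -[\tr _]/(trace_form rho _ _) B_rho.
  congr (_ * _); rewrite -[in RHS]gram_sym [RHS]mxE.
  by rewrite -rowE trmx_delta -colE !mxE.
rewrite -(mxtrace_pid (rank_leq_row B)) /gram_inv mxtrace_mulC -{1}(mulmx_ebase B).
pose P0 : 'M[F]_n := pid_mx (\rank B).
have pidK : P0 *m P0 = P0.
  by rewrite /P0 mul_pid_mx minnn (minn_idPr (rank_leq_row B)).
rewrite -/P0; move: (row_ebase_unit B) (col_ebase_unit B) P0 pidK.
move: (col_ebase B) (row_ebase B) => L U Uu Lu P PP.
by rewrite -!mulmxA mulKVmx // mxtrace_mulC -!mulmxA mulVmx // mulmx1 PP.
Qed.

End Casimir.

(** * Trivialization of cocycles and existence of complements *)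

Definition cocycle m (rho : g -> 'M[F]_m) (phi : g -> 'rV[F]_m) :=
  linear phi /\ forall x y, phi (br x y) = phi x *m rho y - phi y *m rho x.

Lemma cocycle_irreducible m (rho : g -> 'M[F]_m) (phi : g -> 'rV[F]_m) :
    linear rho -> (forall x y, rho (br x y) = commutator (rho x) (rho y)) ->
    (forall U : 'M_m, (forall x, (U *m rho x <= U)%MS) -> U = 0 \/ row_full U) ->
    cocycle rho phi ->
  exists v, forall x, phi x = v *m rho x.
Proof.
move=> rhoL rhoM irr [phiL phiM].
(* The kernel of [rho] is a perfect ideal, and a cocycle vanishes on the brackets of its
   elements. *)
have rho0phi0 x : rho x = 0 -> phi x = 0.
  pose k := [set x | rho x = 0].
  have idk : lie_ideal k.
    split=> [|u w]; last by rewrite /k /= rhoM /commutator => ->; rewrite mulmx0 mul0mx subrr.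
    apply/subspaceP; split=> [|a u w]; rewrite /k /=; first exact: linear_fun0.
    by rewrite rhoL => -> ->; rewrite scaler0 addr0.
  move=> /(ideal_perfect idk); suff : derived_ideal k `<=` [set x | phi x = 0] by apply.
  apply: span_sub.
    apply/subspaceP; split=> [|a u w] /=; first exact: linear_fun0.
    by rewrite phiL => -> ->; rewrite scaler0 addr0.
  move=> _ [a [b [ka kb ->]]] /=; rewrite phiM.
  by rewrite [rho a]ka [rho b]kb !mulmx0 subrr.
have [rho0|] := pselect (forall x, rho x = 0).
  by exists 0 => x; rewrite mul0mx rho0phi0.
move=> nrho0.
have [x0 rhox0] : exists x0, rho x0 != 0.
  by apply: contra_notP nrho0 => no x; apply/eqP; apply: contra_notT no => ?; exists x.
pose rad := [set x | forall y, trace_form rho x y = 0].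
have idrad : lie_ideal rad.
  split=> [|u w ru y]; last by rewrite trace_form_inv // ru.
  apply/subspaceP; split=> [y|a u w ru rw y].
    by rewrite /trace_form (linear_fun0 rhoL) mul0mx mxtrace0.
  by rewrite (trace_forml rhoL) ru rw mulr0 addr0.
(* The radical is perfect, hence acts nilpotently by Cartan's criterion. By Engel's theorem the
   vectors it kills form a nonzero submodule, which is everything by irreducibility. *)
have rad0 x : rad x -> rho x = 0.
  have [|||v [_ v0 vrad]] := @nilpotent_ideal_kernel m rho rhoL rhoM rad setT idrad.
  - move=> y ry; apply: (derived_ideal_nilpotent rhoL rhoM idrad) (ideal_perfect idrad ry).
    by move=> a b ra _; apply: ra.
  - by [].
  - have : exists i, row i (rho x0) != 0.
      apply: contra_notP (elimN eqP rhox0) => no; apply/row_matrixP=> i; rewrite row0.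
      by apply/eqP; apply: contra_notT no => ?; exists i.
    by case=> i; exists (row i (rho x0)).
  have sN : subspace [set v : 'rV[F]_m | forall x, rad x -> v *m rho x = 0].
    apply/subspaceP; split=> [y _|a u w ru rw y ry]; first by rewrite mul0mx.
    by rewrite mulmxDl -scalemxAl ru // rw // scaler0 addr0.
  have [U UE] := subspace_rowspace sN.
  case: (irr U) => [y|U0|Ufull].
  - apply/row_subP=> i; apply/UE => z rz; rewrite row_mul.
    have rowU w : rad w -> row i U *m rho w = 0 by move: w; apply/UE; exact: row_sub.
    have := rhoM y z; rewrite /commutator => /(congr1 (mulmx (row i U))).
    rewrite mulmxBr !mulmxA (rowU z) // mul0mx subr0 => <-.
    by apply: rowU; apply: (lie_idealr _ idrad).
  - by case/eqP: v0; apply/eqP; rewrite -submx0 -U0; apply/UE.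
  - move=> rx; apply/row_matrixP=> i; rewrite row0 rowE.
    have dU : ((delta_mx 0 i : 'rV_m) <= U)%MS by apply: submx_full.
    exact: (UE _).2 dU x rx.
have [B BE] := bilinear_form_mx (trace_forml rhoL) (trace_formr rhoL).
have Brho u : u *m B = 0 -> rho u = 0.
  by move=> uB; apply: rad0 => y; rewrite BE uB mul0mx mxE.
have Bphi u : u *m B = 0 -> phi u = 0 by move=> /Brho; exact: rho0phi0.
pose C := casimir rho B rho.
have Crho z : C *m rho z = rho z *m C by apply: casimir_cocycle.
have Cphi z : casimir rho B phi *m rho z = phi z *m C by apply: casimir_cocycle.
have C0 : C != 0.
  apply/eqP => /(congr1 (fun M => \tr M)); rewrite mxtrace_casimir // mxtrace0.
  move/eqP; rewrite ((pcharf0P F).1 charF0) mxrank_eq0 => /eqP B0.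
  by case/eqP: rhox0; apply: Brho; rewrite B0 mulmx0.
(* Schur's lemma: the kernel of [C] is a submodule, and it is not everything. *)
have Cu : C \in unitmx.
  case: (irr (kermx C)) => [z|/eqP|kerC].
  - by apply/sub_kermxP; rewrite -mulmxA -Crho mulmxA mulmx_ker mul0mx.
  - by rewrite kermx_eq0 row_free_unit.
  - case/eqP: C0; rewrite -[C]mul1mx; apply/sub_kermxP; exact: submx_full.
exists (casimir rho B phi *m invmx C) => z.
have CVrho : rho z *m invmx C = invmx C *m rho z.
  by apply: (canLR (mulmxK Cu)); rewrite -mulmxA -Crho mulKmx.
by rewrite -mulmxA -CVrho mulmxA Cphi mulmxK.
Qed.

Section Split.
Variables (m : nat) (rho : g -> 'M[F]_m).
Hypotheses (rhoL : linear rho)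
  (rhoM : forall x y, rho (br x y) = commutator (rho x) (rho y)).
Variables (r r' : nat) (a : 'M[F]_(r, m)) (s : 'M[F]_(r', m)).
Variables (a' : 'M[F]_(m, r)) (q : 'M[F]_(m, r')).
Hypotheses (stab_a : forall x, (a *m rho x <= a)%MS).
Hypotheses (aa' : a *m a' = 1%:M) (aq : a *m q = 0) (sa' : s *m a' = 0)
  (sq : s *m q = 1%:M) (aqs : a' *m a + q *m s = 1%:M).

Definition sub_rep x := a *m rho x *m a'.
Definition fact_rep x := s *m rho x *m q.

Lemma sub_repE x : sub_rep x *m a = a *m rho x.
Proof.
have /submxP[d dE] := stab_a x.
by rewrite /sub_rep dE -(mulmxA d) aa' mulmx1.
Qed.

Lemma stab_aq x : a *m rho x *m q = 0.
Proof. by rewrite -sub_repE -mulmxA aq mulmx0. Qed.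

Lemma fact_repE x : q *m fact_rep x = rho x *m q.
Proof.
have -> : q *m fact_rep x = (q *m s) *m rho x *m q by rewrite /fact_rep !mulmxA.
have -> : q *m s = 1%:M - a' *m a by rewrite -aqs addrC addKr.
by rewrite !mulmxBl mul1mx -!mulmxA (mulmxA a) stab_aq mulmx0 subr0.
Qed.

Lemma sub_rep_linear : linear sub_rep.
Proof. by move=> c u v; rewrite /sub_rep rhoL mulmxDr mulmxDl -scalemxAr -scalemxAl. Qed.

Lemma fact_rep_linear : linear fact_rep.
Proof. by move=> c u v; rewrite /fact_rep rhoL mulmxDr mulmxDl -scalemxAr -scalemxAl. Qed.

Lemma sub_rep_commutator x y : sub_rep (br x y) = commutator (sub_rep x) (sub_rep y).
Proof.
have E u w : sub_rep u *m sub_rep w = a *m rho u *m rho w *m a'.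
  by rewrite -sub_repE /sub_rep !mulmxA.
by rewrite /commutator !E /sub_rep rhoM /commutator mulmxBr mulmxBl !mulmxA.
Qed.

Lemma fact_rep_commutator x y :
  fact_rep (br x y) = commutator (fact_rep x) (fact_rep y).
Proof.
have E u w : fact_rep u *m fact_rep w = s *m rho u *m rho w *m q.
  by rewrite -!mulmxA -fact_repE /fact_rep !mulmxA.
by rewrite /commutator !E /fact_rep rhoM /commutator mulmxBr mulmxBl !mulmxA.
Qed.

End Split.

(** Whitehead's first lemma. Given a proper nonzero submodule, the cocycle is trivialized by [w] in
    the quotient; subtracting the coboundary of the lift [w *m s] leaves a cocycle with values in
    the submodule. *)
Lemma cocycle_coboundary m (rho : g -> 'M[F]_m) (phi : g -> 'rV[F]_m) :
    linear rho -> (forall x y, rho (br x y) = commutator (rho x) (rho y)) ->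
    cocycle rho phi ->
  exists v, forall x, phi x = v *m rho x.
Proof.
have [d] := ubnP m; elim: d m rho phi => // d IHd m rho phi led rhoL rhoM cphi.
have [irr|] := pselect (forall U : 'M_m, (forall x, (U *m rho x <= U)%MS) ->
    U = 0 \/ row_full U); first exact: cocycle_irreducible irr cphi.
move=> red; have {red}[U [stabU U0 Uf]] :
    exists U : 'M_m, [/\ forall x, (U *m rho x <= U)%MS, U != 0 & ~~ row_full U].
  apply: contra_notP red => no U stabU; have [->|U0] := eqVneq U 0; first by left.
  by right; apply: contra_notT no => Uf; exists U.
have [r [r' [a [s [a' [q [[rU rr' aU] [aa' aq sa' sq aqs]]]]]]]] := split_row_space U.
have stab_a x : (a *m rho x <= a)%MS by rewrite aU (eqmxMr _ aU).
have r0 : (0 < r)%N by rewrite rU lt0n mxrank_eq0.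
have r'0 : (r < m)%N by rewrite rU ltn_neqAle rank_leq_row andbT.
have fE := fact_repE stab_a aa' aq aqs; have sE := sub_repE stab_a aa'.
have [phiL phiM] := cphi.
have mulq x y : phi x *m rho y *m q = phi x *m q *m fact_rep rho s q y.
  by rewrite -!mulmxA fE.
have [||||w wE] := IHd r' (fact_rep rho s q) (fun x => phi x *m q).
- by lia.
- exact: fact_rep_linear.
- by apply: fact_rep_commutator; eauto.
- split=> [c u v|x y]; first by rewrite phiL mulmxDl -scalemxAl.
  by rewrite phiM mulmxBl !mulq.
pose phi' x := phi x - w *m s *m rho x.
have phi'L : linear phi'.
  by move=> c u v; rewrite /phi' phiL rhoL mulmxDr -scalemxAr scalerBr opprD addrACA.
have phi'M x y : phi' (br x y) = phi' x *m rho y - phi' y *m rho x.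
  rewrite /phi' phiM rhoM /commutator mulmxBr !mulmxBl !mulmxA.
  by rewrite !opprD addrACA.
have phi'q x : phi' x *m q = 0.
  rewrite mulmxBl wE -!mulmxA -fE (mulmxA s) sq mul1mx.
  exact: subrr.
have phi'a x : phi' x = phi' x *m a' *m a.
  by rewrite -[LHS]mulmx1 -aqs mulmxDr !mulmxA phi'q mul0mx addr0.
have [||||u uE] := IHd r (sub_rep rho a a') (fun x => phi' x *m a').
- by lia.
- exact: sub_rep_linear.
- by apply: sub_rep_commutator.
- split=> [c x y|x y]; first by rewrite phi'L mulmxDl -scalemxAl.
  have E z t : phi' z *m a' *m sub_rep rho a a' t = phi' z *m rho t *m a'.
    by rewrite {2}(phi'a z) /sub_rep !mulmxA.
  by rewrite phi'M mulmxBl !E.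
exists (w *m s + u *m a) => x.
rewrite mulmxDl -(mulmxA u) -sE (mulmxA u) -uE -phi'a.
by rewrite /phi' addrC subrK.
Qed.

Lemma weyl_complement m (rho : g -> 'M[F]_m) (U : 'M[F]_m) :
    linear rho -> (forall x y, rho (br x y) = commutator (rho x) (rho y)) ->
    (forall x, (U *m rho x <= U)%MS) ->
  exists r (T : 'M[F]_(r, m)), [/\ forall x, (T *m rho x <= T)%MS,
    forall v : 'rV_m, exists2 u, (u <= U)%MS & (v - u <= T)%MS
    & forall v : 'rV_m, (v <= U)%MS -> (v <= T)%MS -> v = 0].
Proof.
move=> rhoL rhoM stabU.
have [r [r' [a [s [a' [q [[_ _ aU] [aa' aq sa' sq aqs]]]]]]]] := split_row_space U.
have stab_a x : (a *m rho x <= a)%MS by rewrite aU (eqmxMr _ aU).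
have fE := fact_repE stab_a aa' aq aqs; have sE := sub_repE stab_a aa'.
pose sR := sub_rep rho a a'; pose fR := fact_rep rho s q.
have sRM x y : sR (br x y) = commutator (sR x) (sR y) by apply: sub_rep_commutator.
have fRM x y : fR (br x y) = commutator (fR x) (fR y) by apply: fact_rep_commutator; eauto.
have sRL : linear sR by exact: sub_rep_linear.
have fRL : linear fR by exact: fact_rep_linear.
(* [sigma] is the action on linear maps from the quotient to the submodule, flattened by [mxvec] so
   as to act on row vectors. *)
have /choice[sigma sigmaE] : forall x, exists S : 'M[F]_(r' * r), forall c : 'M[F]_(r', r),
    mxvec c *m S = mxvec (c *m sR x - fR x *m c).
  move=> x; apply: (@linear_mxvecP F r' r (fun c => c *m sR x - fR x *m c)).
  move=> k c d; rewrite mulmxDl mulmxDr -scalemxAl -scalemxAr scalerBr opprD.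
  by rewrite addrACA.
have mxvec_ext (M1 M2 : 'M[F]_(r' * r)) :
    (forall Z : 'M[F]_(r', r), mxvec Z *m M1 = mxvec Z *m M2) -> M1 = M2.
  move=> M12; apply/row_matrixP=> i; rewrite !rowE.
  by rewrite -[delta_mx 0 i]vec_mxK; apply: M12.
(* [gam], the off-diagonal block of [rho], is a cocycle with values in the module
   of linear maps from the quotient by [U] to [U]; trivializing it moves the
   complement [s] of [U] to a stable one. *)
pose gam x := s *m rho x *m a'.
have [|||v vE] := @cocycle_coboundary _ sigma (fun x => mxvec (gam x)).
- move=> k x y; apply: mxvec_ext => c.
  rewrite mulmxDr -scalemxAr !sigmaE sRL fRL -linearP; congr mxvec.
  rewrite mulmxDr mulmxDl -scalemxAr -scalemxAl scalerBr opprD.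
  by rewrite addrACA.
- move=> x y; apply: mxvec_ext => c; rewrite /commutator mulmxBr !mulmxA !sigmaE.
  rewrite -linearB; congr mxvec; rewrite sRM fRM /commutator.
  rewrite mulmxBr !mulmxBl !mulmxBr !mulmxA.
  move: (c *m sR x *m sR y) (c *m sR y *m sR x) (fR x *m fR y *m c) => p1 p2 p3.
  move: (fR y *m fR x *m c) (fR x *m c *m sR y) (fR y *m c *m sR x) => p4 p5 p6.
  by apply/matrixP=> i j; rewrite !mxE; ring.
- have gamL : linear gam.
    by move=> k x y; rewrite /gam rhoL mulmxDr mulmxDl -scalemxAr -scalemxAl.
  split=> [k x y|x y]; first by rewrite gamL linearP.
  rewrite !sigmaE -linearB; congr mxvec.
  have E z t : s *m rho z *m rho t *m a' = gam z *m sR t + fR z *m gam t.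
    rewrite -[s *m rho z]mulmx1 -aqs mulmxDr !mulmxDl /gam /sR /sub_rep /fR /fact_rep.
    by rewrite !mulmxA.
  rewrite {1}/gam rhoM /commutator mulmxBr mulmxBl !(mulmxA s) !E.
  move: (gam x *m sR y) (gam y *m sR x) (fR x *m gam y) (fR y *m gam x) => p1 p2 p3 p4.
  by apply/matrixP=> i j; rewrite !mxE; ring.
pose c := vec_mx v : 'M_(r', r).
have gamE x : gam x = c *m sR x - fR x *m c.
  by apply: (can_inj mxvecK); rewrite vE -sigmaE vec_mxK.
have srho x : s *m rho x = gam x *m a + fR x *m s.
  by rewrite -[LHS]mulmx1 -aqs mulmxDr !mulmxA.
(* The corrected section satisfies [(s - c *m a) *m rho x = fR x *m (s - c *m a)]. *)
exists r', (s - c *m a); split.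
- move=> x; apply/submxP; exists (fR x).
  rewrite mulmxBl srho gamE mulmxBl mulmxBr -(mulmxA c (sR x)) (sE x : sR x *m a = _).
  rewrite -(mulmxA c a) (mulmxA (fR x)).
  move: (c *m (a *m rho x)) (fR x *m c *m a) (fR x *m s) => p1 p2 p3.
  by apply/matrixP=> i j; rewrite !mxE; ring.
- move=> w; exists (w *m a' *m a + w *m q *m c *m a).
    by rewrite -aU -mulmxDl submxMl.
  apply/submxP; exists (w *m q); rewrite -{1}[w]mulmx1 -aqs mulmxDr mulmxBr !mulmxA.
  by rewrite opprD addrA [w *m a' *m a + _]addrC addrK.
- move=> w; rewrite -aU => /submxP[e ->] /submxP[f Df].
  have := congr1 (mulmx^~ q) Df; rewrite -!mulmxA aq mulmx0 mulmxBl sq -mulmxA aq.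
  rewrite mulmx0 subr0 mulmx1 => f0; by rewrite Df -f0 mul0mx.
Qed.

End Semisimple.
End LieAlgebra.

(** * Finite dimension and complete reducibility *)

Section FiniteDimension.
Variables (F : fieldType) (V : lmodType F).
Implicit Types (W N T : set V).

Lemma linear_image_subspace (U : lmodType F) (f : U -> V) (W : set U) :
  linear f -> subspace W -> subspace (f @` W).
Proof.
move=> lf sW; apply/subspaceP; split; first by exists 0; [exact: sub0|exact: linear_fun0].
move=> a _ _ [u Wu <-] [v Wv <-]; exists (a *: u + v); last exact: lf.
by apply: (subD sW) => //; apply: (subZ sW).
Qed.

Lemma linear_preimage_subspace (U : lmodType F) (f : U -> V) W :
  linear f -> subspace W -> subspace (f @^-1` W).
Proof.
move=> lf sW; apply/subspaceP; split=> [|a u v Wu Wv] /=.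
  by rewrite (linear_fun0 lf); apply: sub0.
by rewrite lf; apply: (subD sW) => //; apply: (subZ sW).
Qed.

Lemma subspaceT (U : lmodType F) : subspace [set: U].
Proof. by apply/subspaceP. Qed.

Lemma subspaceI W N : subspace W -> subspace N -> subspace (W `&` N).
Proof.
move=> sW sN; apply/subspaceP; split=> [|a u v [Wu Nu] [Wv Nv]].
  by split; apply: sub0.
by split; [apply: (subD sW) => //; apply: subZ|apply: (subD sN) => //; apply: subZ].
Qed.

Lemma fin_dimP W : fin_dim W <->
  exists k (p : 'rV[F]_k -> V), linear p /\ W = p @` setT.
Proof.
split=> [[s ->]|[k [p [pL ->]]]].
  pose p (u : 'rV[F]_(size s)) := \sum_i u 0 i *: s`_i.
  have pL : linear p.
    move=> a u v; rewrite /p scaler_sumr -big_split; apply: eq_bigr => i _ /=.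
    by rewrite !mxE scalerDl scalerA.
  exists (size s), p; split=> //; apply/seteqP; split.
    apply: span_sub; first exact: (linear_image_subspace pL (subspaceT _)).
    move=> x /= xs; have ltx : (index x s < size s)%N by rewrite index_mem.
    exists (delta_mx 0 (Ordinal ltx)) => //; rewrite /p (bigD1 (Ordinal ltx)) //=.
    rewrite mxE !eqxx scale1r nth_index // big1 ?addr0 // => i /negPf ni.
    by rewrite mxE ni andbF scale0r.
  move=> _ [u _ <-]; apply: (sub_sum (span_subspace _)) => i _.
  by apply: (subZ (span_subspace _)); apply: mem_span; rewrite /= mem_nth.
exists [seq p (delta_mx 0 i) | i : 'I_k]; apply/seteqP; split.
  move=> _ [u _ <-]; rewrite [u]row_sum_delta (linear_fun_sum pL).
  apply: (sub_sum (span_subspace _)) => i _; rewrite (linear_funZ pL).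
  by apply: (subZ (span_subspace _)); apply: mem_span; rewrite /= map_f ?mem_enum.
apply: span_sub; first exact: (linear_image_subspace pL (subspaceT _)).
by move=> _ /= /mapP[i _ ->]; exists (delta_mx 0 i).
Qed.

(** The number [k] of parameters is the measure for inductions on dimension. It may exceed the
    dimension of the image, yet a proper subspace always has a parametrization with fewer
    parameters. *)
Lemma fin_dim_proper k (p : 'rV[F]_k -> V) N : linear p -> subspace N ->
    N `<=` p @` setT -> N <> p @` setT ->
  exists r (p' : 'rV[F]_r -> V), [/\ linear p', N = p' @` setT & (r < k)%N].
Proof.
move=> pL sN Np Nnp; have [A AE] := subspace_rowspace (linear_preimage_subspace pL sN).
pose p' (u : 'rV[F]_(\rank A)) := p (u *m row_base A).
have NE : N = p' @` setT.
  apply/seteqP; split=> [x Nx|_ [u _ <-]].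
    have [u _ ux] := Np x Nx.
    have /AE : (p @^-1` N) u by rewrite /= ux.
    by rewrite -(eq_row_base A) => /submxP[w Dw]; exists w; rewrite // /p' -Dw.
  by apply/AE; rewrite -(eq_row_base A) submxMl.
exists (\rank A), p'; split=> //.
  by move=> a u v; rewrite /p' mulmxDl -scalemxAl pL.
rewrite ltn_neqAle rank_leq_row andbT; apply/negP => Afull; apply: Nnp.
apply/seteqP; split=> // _ [u _ <-]; apply/AE; exact: submx_full.
Qed.

Lemma fin_dim_sub W N : fin_dim W -> subspace N -> N `<=` W -> fin_dim N.
Proof.
move=> fW sN NW; have [->//|NnW] := pselect (N = W).
move: fW NW NnW => /fin_dimP[k [p [pL ->]]] NW NnW.
have [r [p' [p'L -> _]]] := fin_dim_proper pL sN NW NnW.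
by apply/fin_dimP; exists r, p'.
Qed.

(** A complement of the kernel of a parametrization of [W] provides injective coordinates. *)
Lemma fin_dim_coord W : fin_dim W ->
  exists n (j : 'rV[F]_n -> V), [/\ linear j, injective j & W = j @` setT].
Proof.
case/fin_dimP=> k [p [pL WE]].
have s0 : subspace [set 0 : V].
  by apply/subspaceP; split=> // a u v -> ->; rewrite scaler0 addr0.
have [A AE] := subspace_rowspace (linear_preimage_subspace pL s0).
have [r [n [a [s [a' [q [[_ _ aA] [aa' aq sa' sq aqs]]]]]]]] := split_row_space A.
exists n, (fun u => p (u *m s)); split.
- by move=> c u v; rewrite mulmxDl -scalemxAl pL.
- move=> u v /eqP; rewrite -subr_eq0 -(linear_funN pL) -(linear_funD pL) -mulmxBl.
  move=> /eqP/AE; rewrite -aA => /submxP[d /(congr1 (mulmx^~ q))].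
  by rewrite -!mulmxA sq aq mulmx0 mulmx1 => /eqP; rewrite subr_eq0 => /eqP.
- rewrite WE; apply/seteqP; split=> _ [u _ <-]; last by exists (u *m s).
  exists (u *m q) => //; apply/eqP; rewrite -subr_eq0 -(linear_funN pL) -(linear_funD pL).
  apply/eqP/AE; rewrite -aA -[u in _ - u]mulmx1 -aqs mulmxDr !mulmxA opprD addrCA subrr.
  by rewrite addr0 -mulNmx submxMl.
Qed.

End FiniteDimension.

Section CompleteReducibility.
Variables (F : fieldType) (V : lmodType F) (sub : set V -> Prop).
Hypotheses (sub_sub : forall W, sub W -> subspace W)
  (sub_setI : forall W N, sub W -> sub N -> sub (W `&` N)).
Implicit Types (W N T : set V).

Lemma exists_irreducible W : fin_dim W -> sub W -> W <> [set 0] ->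
  exists2 N, irreducible sub N & N `<=` W.
Proof.
case/fin_dimP=> k [p [pL ->]]; have [d] := ubnP k.
elim: d k p pL => // d IHd k p pL lek sW W0.
have [irr|] := pselect (forall N, sub N -> N `<=` p @` setT ->
    N = [set 0] \/ N = p @` setT); first by exists (p @` setT).
move=> red; have {red}[N [sN NW N0 NnW]] : exists N, [/\ sub N, N `<=` p @` setT,
    N <> [set 0] & N <> p @` setT].
  apply: contra_notP red => no N sN NW; have [->|N0] := pselect (N = [set 0]); first by left.
  by right; apply: contra_notP no => NnW; exists N.
have [r [p' [p'L NE ltrk]]] := fin_dim_proper pL (sub_sub sN) NW NnW.
rewrite NE in NW sN N0.
have [|M irrM MN] := IHd r p' p'L _ sN N0; first exact: leq_trans ltrk _.
by exists M => // v /MN/NW.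
Qed.

Lemma direct_sum_option (I : choiceType) (N : I -> set V) (N0 T W : set V) :
    subspace W -> subspace N0 -> N0 `<=` W -> T `<=` W ->
    (forall x, W x -> exists2 u, N0 u & T (x - u)) ->
    (forall x, N0 x -> T x -> x = 0) -> subspace T ->
    direct_sum N T ->
  direct_sum (fun i => if i is Some i' then N i' else N0) W.
Proof.
move=> sW sN0 N0W TW WNT N0T sT [TE Nind]; split.
  apply/seteqP; split=> [x /WNT[u N0u Txu]|].
    rewrite -[x](subrK u); apply: (subD (span_subspace _)); last first.
      by apply: mem_span; exists None.
    move: Txu; rewrite {1}TE; apply: span_sub; first exact: span_subspace.
    by move=> y [i _ Niy]; apply: mem_span; exists (Some i).
  apply: span_sub => // y [[i|] _ Ny]; last exact: N0W.
  by apply: TW; rewrite TE; apply: mem_span; exists i.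
move=> s v us Nv sum0.
pose s' := pmap id s; pose v' i := v (Some i).
have us' : uniq s' by apply: pmap_uniq us => -[].
have memS i : (i \in s') = (Some i \in s).
  by rewrite /s' mem_pmap map_id.
have Ns'T : T (\sum_(i <- s') v' i).
  apply: (sub_sum sT) => i _; rewrite TE; apply: mem_span; exists i => //.
  exact: (Nv (Some i)).
have sumE : \sum_(i <- s) v i = (if None \in s then v None else 0) + \sum_(i <- s') v' i.
  rewrite /s'; elim: s us {sum0 s' us' memS Ns'T} => [|[i|] s IHs] /=.
  - by rewrite !big_nil addr0.
  - by case/andP=> _ /IHs IH; rewrite !big_cons IH [LHS]addrCA.
  - case/andP=> nNs /IHs IH; rewrite big_cons IH (negPf nNs).
    by rewrite add0r.
have N00 : (if None \in s then v None else 0) = 0.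
  apply: N0T; first by case: ifP => _; [exact: (Nv None)|exact: sub0].
  move/eqP: sum0; rewrite sumE addr_eq0 => /eqP->.
  exact: (subN sT).
have sum'0 : \sum_(i <- s') v' i = 0 by move: sum0; rewrite sumE N00 add0r.
move=> [i|] si; last by rewrite si in N00.
by apply: (Nind s' v' us' _ sum'0); rewrite ?memS // => k; apply: (Nv (Some k)).
Qed.

(** An irreducible [N] is split off and the induction continues with its complement [T]. The
    hypothesis passes to [T] by the modular law: complements inside [T] are intersections with
    [T]. *)
Lemma completely_reducible_complemented W : fin_dim W -> sub W ->
    (forall N, sub N -> N `<=` W -> exists T, [/\ sub T, T `<=` W,
       forall x, W x -> exists2 u, N u & T (x - u)
       & forall x, N x -> T x -> x = 0]) ->
  completely_reducible sub W.
Proof.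
case/fin_dimP=> k [p [pL ->]] {W}; have [d] := ubnP k.
elim: d k p pL => // d IHd k p pL lek; set W := p @` setT => sW comp.
have [W0|W0] := pselect (W = [set 0]).
  exists void, (fun i : void => match i return set V with end); split=> [[]|].
  split; last by move=> s v us Nv _ [].
  rewrite W0; apply/seteqP; split=> [x ->|]; first exact: (sub0 (span_subspace _)).
  by rewrite -W0; apply: span_sub; [exact: sub_sub|move=> x [[]]].
have fW : fin_dim W by apply/fin_dimP; exists k, p.
have [N irrN NW] := exists_irreducible fW sW W0.
have [sN N0 _] := irrN.
have [T [sT TW WNT NT]] := comp N sN NW.
have TnW : T <> W.
  move=> TW'; apply: N0; apply/seteqP; split=> [x Nx|_ ->]; last exact: (sub0 (sub_sub sN)).
  by apply: NT => //; rewrite TW'; apply: NW.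
have [r [p' [p'L TE ltrk]]] := fin_dim_proper pL (sub_sub sT) TW TnW.
have [|||I [M [irrM TM]]] := IHd r p' p'L; rewrite -?TE //.
- exact: leq_trans ltrk _.
- move=> N' sN' N'T; have N'W : N' `<=` W by move=> x /N'T/TW.
  have [T' [sT' T'W WN'T' N'T']] := comp N' sN' N'W.
  exists (T' `&` T); split.
  + exact: sub_setI.
  + by move=> x [].
  + move=> x Tx; have [u N'u T'xu] := WN'T' x (TW x Tx); exists u => //; split=> //.
    by apply: (subB (sub_sub sT)) => //; apply: N'T.
  + by move=> x N'x [T'x _]; apply: N'T'.
exists (option I), (fun i => if i is Some i' then M i' else N); split; first by case.
rewrite -TE in TM.
exact: (direct_sum_option (sub_sub sW) (sub_sub sN) NW TW WNT NT (sub_sub sT) TM).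
Qed.

End CompleteReducibility.

Lemma completely_reducible_preimage (F : fieldType) (V V' : lmodType F)
    (sub : set V -> Prop) (sub' : set V' -> Prop) (j : V' -> V) (W : set V) :
    linear j -> injective j -> W = j @` setT ->
    (forall N, sub N -> subspace N) ->
    (forall N, sub' N <-> sub (j @` N)) ->
  completely_reducible sub W -> completely_reducible sub' setT.
Proof.
move=> jL jI WE sub_sub subE [I [N [irrN [WN Nind]]]].
have NW i : N i `<=` W by rewrite WN => x Nx; apply: mem_span; exists i.
have jN i : j @` (j @^-1` N i) = N i.
  apply/seteqP; split=> [_ [x Nx <-]//|x Nx].
  by have := NW i x Nx; rewrite WE => -[u _ ux]; exists u; rewrite //= ux.
have j0 : j 0 = 0 := linear_fun0 jL.
have jK A : j @^-1` (j @` A) = A.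
  by apply/seteqP; split=> [x [y Ay /jI<-]//|x Ax]; exists x.
have j00 : j @^-1` [set 0] = [set 0].
  by apply/seteqP; split=> [x /= jx|_ ->//]; apply: jI; rewrite j0.
exists I, (fun i => j @^-1` N i); split=> [i|].
  have [sN N0 Nirr] := irrN i; split.
  - by apply/subE; rewrite jN.
  - move=> E; apply: N0; rewrite -jN E.
    by apply/seteqP; split=> [_ [_ -> <-]//|_ ->]; exists 0.
  - move=> A /subE sA AN; have [|A0|AE] := Nirr _ sA.
    + by move=> _ [x /AN Nx <-].
    + by left; rewrite -[A]jK A0.
    + by right; rewrite -[LHS]jK AE.
split=> [|s v us Nv sum0 i si].
  apply/seteqP; split=> // x _.
  have : W (j x) by rewrite WE; exists x.
  rewrite WN => Hx; rewrite -[span _]jK /=; move: (j x) Hx.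
  apply: span_sub; first exact: (linear_image_subspace jL (span_subspace _)).
  move=> y [i _ Niy]; have := NW i y Niy; rewrite WE => -[u _ uy].
  by exists u => //; apply: mem_span; exists i => //=; rewrite uy.
apply: jI; rewrite j0; apply: (Nind s (j \o v)) => //.
by rewrite -(linear_fun_sum jL) sum0 j0.
Qed.

(** * Semisimple Leibniz algebras *)

Section Leibniz.
Variables (F : fieldType) (L : leibnizType F).
Implicit Types (x y z : L) (I N G : set L).
Local Notation K := (leib [set: L]).

Lemma lmulDl x y z : (x + y) ** z = x ** z + y ** z.
Proof. exact: linearDl. Qed.
Lemma lmulDr x y z : z ** (x + y) = z ** x + z ** y.
Proof. exact: linearDr. Qed.
Lemma lmulZl a x y : (a *: x) ** y = a *: (x ** y).
Proof. exact: linearZl. Qed.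
Lemma lmulZr a x y : x ** (a *: y) = a *: (x ** y).
Proof. exact: linearZr. Qed.
Lemma lmul0 x : 0 ** x = 0. Proof. exact: linear0l. Qed.
Lemma lmulr0 x : x ** 0 = 0. Proof. exact: linear0r. Qed.

Lemma lmulBl x y z : (x - y) ** z = x ** z - y ** z. Proof. exact: linearBl. Qed.
Lemma lmulBr x y z : z ** (x - y) = z ** x - z ** y. Proof. exact: linearBr. Qed.
Lemma lmulNr x y : x ** (- y) = - (x ** y). Proof. exact: linearNr. Qed.

Lemma leib_sub : subspace K. Proof. exact: span_subspace. Qed.

(** For a square this is the Leibniz identity [z (z y) = (z z) y + z (z y)]. *)
Lemma leib_mul0 x y : K x -> x ** y = 0.
Proof.
have sW : subspace [set z | z ** y = 0].
  apply/subspaceP; split=> [|a u v] /=; first exact: lmul0.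
  by rewrite lmulDl lmulZl => -> ->; rewrite scaler0 addr0.
apply: (span_sub sW) => _ [z _ <-] /=.
have /eqP := left_leibniz z z y.
by rewrite -{1}[z ** (z ** y)]add0r (inj_eq (addIr _)) eq_sym => /eqP.
Qed.

Lemma leib_sq x : K (x ** x). Proof. by apply: mem_span; exists x. Qed.

Lemma leib_anti x y : K (x ** y + y ** x).
Proof.
have -> : x ** y + y ** x = (x + y) ** (x + y) - (x ** x + y ** y).
  by rewrite lmulDl !lmulDr (addrC (y ** x)) addrACA [X in X - _]addrC addrK addrC.
by apply: (subB leib_sub); [|apply: (subD leib_sub)]; apply: leib_sq.
Qed.

Lemma leib_mull x y : K y -> K (x ** y).
Proof.
have sW : subspace [set z | K (x ** z)].
  apply/subspaceP; split=> [|a u v Ku Kv] /=; first by rewrite lmulr0; apply: sub0 leib_sub.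
  by rewrite lmulDr lmulZr; apply: (subD leib_sub) => //; apply: (subZ leib_sub).
apply: (span_sub sW) => _ [z _ <-] /=.
by rewrite left_leibniz; apply: leib_anti.
Qed.

Lemma derived0 n I : subspace I -> derived n I 0.
Proof. by case: n => [|n] sI; [exact: sub0|exact: (sub0 (span_subspace _))]. Qed.

Lemma derived_sub_leib n I : derived n I `<=` K -> subspace I -> solvable I.
Proof.
move=> IK sI; exists n.+1; apply/seteqP; split=> [|_ ->]; last exact: (@derived0 n.+1).
apply: span_sub.
  by apply/subspaceP; split=> // a u v -> ->; rewrite scaler0 addr0.
by move=> _ [x /IK Kx [y _ <-]] /=; apply: leib_mul0.
Qed.

(* [L] is a module over the semisimple Lie algebra [L / Leib(L)], as [Leib(L)]
   acts trivially from the left, so that Weyl's theorem applies. *)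
Lemma left_ideal_complement (charF0 : [pchar F] =i pred0) :
    fin_dim [set: L] -> semisimple [set: L] ->
  forall N, subspace N -> (forall x y, N y -> N (x ** y)) ->
  exists T, [/\ subspace T, forall x y, T y -> T (x ** y),
    forall x, exists2 u, N u & T (x - u) & forall x, N x -> T x -> x = 0].
Proof.
move=> /fin_dim_coord[m [j [jL jI jT]]] ssL N sN NL.
have /choice[c cK] : forall x, exists u, j u = x.
  by move=> x; have : [set: L] x by []; rewrite jT => -[u _ ux]; exists u.
have jK : cancel j c by move=> u; apply: jI; rewrite cK.
have cL : linear c by move=> a x y; apply: jI; rewrite jL !cK.
have [A AE] := subspace_rowspace (linear_preimage_subspace jL leib_sub).
have [r [n [a [s [a' [q [[_ _ aA] [aa' aq sa' sq aqs]]]]]]]] := split_row_space A.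
(* [sec] and [pr] model the quotient by [K] on row vectors. Left multiplication by an element
   depends only on its class, so [br] is the product of the quotient. *)
pose sec (u : 'rV[F]_n) := j (u *m s); pose pr x := c x *m q.
have secL : linear sec by move=> b u v; rewrite /sec mulmxDl -scalemxAl jL.
have prL : linear pr by move=> b u v; rewrite /pr cL mulmxDl -scalemxAl.
have secK u : pr (sec u) = u by rewrite /pr jK -mulmxA sq mulmx1.
have pr0 x : K x <-> pr x = 0.
  have -> : K x <-> (c x <= a)%MS by rewrite aA -AE /= cK.
  split=> [/submxP[d Dd]|prx0]; first by rewrite /pr Dd -mulmxA aq mulmx0.
  rewrite -[c x]mulmx1 -aqs mulmxDr [in X in _ + X]mulmxA -/(pr x) prx0.
  by rewrite mul0mx addr0 mulmxA submxMl.
have prK x : K (x - sec (pr x)).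
  by apply/pr0; rewrite (linear_funD prL) (linear_funN prL) secK subrr.
have secM x y : sec (pr x) ** y = x ** y.
  apply/eqP; rewrite eq_sym -subr_eq0 -lmulBl.
  by rewrite (leib_mul0 _ (prK x)).
pose br u v := pr (sec u ** sec v).
have prM x y : pr (x ** y) = br (pr x) (pr y).
  rewrite /br secM -{1}[y](subrK (sec (pr y))) lmulDr (linear_funD prL).
  by rewrite (pr0 _).1 ?add0r //; apply: leib_mull.
have brDl v : linear (br^~ v).
  by move=> b x y; rewrite /br secL lmulDl lmulZl prL.
have brDr u : linear (br u).
  by move=> b x y; rewrite /br secL lmulDr lmulZr prL.
have brxx u : br u u = 0 by apply/pr0; apply: leib_sq.
have jacobi u v w : br u (br v w) = br (br u v) w - br (br u w) v.
  have E x y z : pr (x ** (y ** z)) = br (pr x) (br (pr y) (pr z)) by rewrite !prM.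
  have E' x y z : pr ((x ** y) ** z) = br (br (pr x) (pr y)) (pr z) by rewrite !prM.
  have := congr1 pr (left_leibniz (sec u) (sec v) (sec w)).
  rewrite (linear_funD prL) !E E' !secK => ->; congr (_ + _).
  by rewrite [LHS](brC brDl brDr brxx).
(* The preimage of an abelian ideal of the quotient is an ideal of [L] with products in [K]; it is
   therefore solvable, hence contained in [K]. *)
have ss_br (I : set 'rV[F]_n) : lie_ideal br I ->
    (forall u v, I u -> I v -> br u v = 0) -> forall u, I u -> u = 0.
  move=> idI Iab u Iu; have [sI HI] := idI.
  have spI : subspace (pr @^-1` I) by apply: linear_preimage_subspace prL sI.
  suff : K (sec u) by move/pr0; rewrite secK.
  have := ssL (pr @^-1` I); apply; last by rewrite /= secK.
    split=> // x y _ /= Iy; rewrite !prM; split; last exact: HI.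
    exact: (lie_idealr brDl brDr brxx _ idI).
  apply: (@derived_sub_leib 1) => //; apply: span_sub leib_sub _.
  by move=> _ [x Ix [y Iy <-]]; apply/pr0; rewrite prM Iab.
(* The sign turns the left action into a right one, for matrices acting on row vectors. *)
have /choice[rho rhoE] : forall u, exists M : 'M[F]_m, forall v, v *m M = - c (sec u ** j v).
  move=> u; apply: linear_mxP => b v w.
  by rewrite jL lmulDr lmulZr cL opprD scalerN.
have mx_inj (M M' : 'M[F]_m) : (forall v : 'rV_m, v *m M = v *m M') -> M = M'.
  by move=> E; apply/row_matrixP=> i; rewrite !rowE.
have cN x : c (- x) = - c x := linear_funN cL x.
have jN u : j (- u) = - j u := linear_funN jL u.
have rhoL : linear rho.
  move=> b u v; apply: mx_inj => w; rewrite mulmxDr -scalemxAr !rhoE secL.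
  by rewrite lmulDl lmulZl cL opprD scalerN.
have rhoM u v : rho (br u v) = commutator (rho u) (rho v).
  apply: mx_inj => w; rewrite /commutator mulmxBr !mulmxA !rhoE /br secM.
  rewrite !jN !cK !lmulNr !cN !opprK [in RHS](left_leibniz (sec u)).
  by rewrite (linear_funD cL) opprD addrCA subrr addr0.
have [U UE] := subspace_rowspace (linear_preimage_subspace jL sN).
have UN x : N x <-> (c x <= U)%MS by rewrite -UE /= cK.
have [|k [T [Tstab UT UTI]]] :=
    weyl_complement charF0 brDl brDr brxx jacobi ss_br rhoL rhoM (U := U).
  move=> u; apply/row_subP=> i; rewrite row_mul rhoE -cN; apply/UN.
  by rewrite -lmulNr; apply: NL; rewrite -jN; apply/UN; rewrite jK (eqmx_opp _) row_sub.
exists (c @^-1` [set v | (v <= T)%MS]); split.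
- apply: linear_preimage_subspace cL _; apply/subspaceP; split=> [|b u v]; first exact: sub0mx.
  by move=> /= uT vT; rewrite addmx_sub // scalemx_sub.
- move=> x y /= yT; rewrite -secM -[c _]opprK -[y in X in - X]cK -rhoE eqmx_opp.
  exact: submx_trans (submxMr _ yT) (Tstab _).
- move=> x; have [u uU xuT] := UT (c x); exists (j u); first by apply/UN; rewrite jK.
  by rewrite /= (linear_funD cL) cN jK.
- by move=> x /UN xU /= xT; rewrite -[x]cK (UTI _ xU xT) (linear_fun0 jL).
Qed.


Lemma leib_complement_mul (G : set L) x y : (forall z, exists2 u, K u & G (z - u)) ->
  exists2 g, G g & x ** y = g ** y.
Proof.
move=> GK; have [u Ku Gxu] := GK x; exists (x - u) => //.
by rewrite lmulBl (leib_mul0 _ Ku) subr0.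
Qed.

(** For a solvable ideal [I] of [G], the sum [H = I + K] is an ideal of [L] whose derived series is
    contained in that of [I] plus [K]. So [H] is solvable, hence inside [K], and [I] is in the
    intersection of [G] and [K], which is 0. *)
Lemma semisimple_leib_complement G : semisimple [set: L] -> subspace G ->
    (forall x, exists2 u, K u & G (x - u)) -> (forall x, K x -> G x -> x = 0) ->
  semisimple G.
Proof.
move=> ssL sG GK KG I [sI IG GI] [n In0] x Ix.
pose H := [set y | exists2 i, I i & K (y - i)].
have IH : I `<=` H by move=> i Ii; exists i => //; rewrite subrr; apply: (sub0 leib_sub).
have sumP (W : set L) : subspace W -> subspace [set y | exists2 i, W i & K (y - i)].
  move=> sW; apply/subspaceP; split=> [|a u v [i Wi Ki] [k Wk Kk]].
    by exists 0; [exact: sub0|rewrite subrr; apply: (sub0 leib_sub)].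
  exists (a *: i + k); first by apply: (subD sW) => //; apply: (subZ sW).
  by rewrite opprD addrACA -scalerBr; apply: (subD leib_sub) => //; apply: (subZ leib_sub).
have sH : subspace H := sumP I sI.
suff : K x by move=> Kx; rewrite (KG x Kx (IG x Ix)); apply: (sub0 (span_subspace _)).
apply: (ssL H); last exact: IH.
- split=> // a y _ [i Ii Kyi]; split.
    exists (a ** i); last by rewrite -lmulBr; apply: leib_mull.
    by have [g Gg ->] := leib_complement_mul a i GK; apply: (GI g i Gg Ii).1.
  have [u Ku Gau] := GK a; exists (i ** (a - u)); first exact: (GI _ _ Gau Ii).2.
  have -> : y ** a = i ** a.
    by apply/eqP; rewrite -subr_eq0 -lmulBl (leib_mul0 _ Kyi).
  by rewrite -lmulBr opprB addrCA subrr addr0; apply: leib_mull.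
apply: (@derived_sub_leib n) => //.
suff DH m : derived m H `<=` [set y | exists2 i, derived m I i & K (y - i)].
  by move=> y /DH[i]; rewrite In0 => ->; rewrite subr0.
elim: m => [//|m IHm]; apply: span_sub; first exact/sumP/span_subspace.
move=> _ [y /IHm[i Di Kyi] [z /IHm[k Dk Kzk] <-]]; exists (i ** k).
  by apply: mem_span; exists i => //; exists k.
have -> : y ** z = i ** z.
  by apply/eqP; rewrite -subr_eq0 -lmulBl (leib_mul0 _ Kyi).
by rewrite -lmulBr; apply: leib_mull.
Qed.

Lemma leib_decomposition (charF0 : [pchar F] =i pred0) :
    fin_dim [set: L] /\ semisimple [set: L] ->
  exists G : set L,
         [/\ subalgebra G, lie G, fin_dim G & semisimple G] /\
         direct_sum2 [set: L] G (leib [set: L]) /\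
         let K : set (adjoint L) := leib [set: L] in
         [/\ subbimodule G K, fin_dim K,
             completely_reducible (@subbimodule F L G (adjoint L)) K,
             antisymmetric_bimod G K
           & forall N : set (adjoint L), subbimodule G N -> N `<=` K ->
               trivial_bimod G N -> N = [set 0]].
Proof.
move=> [fL ssL]; have compl := left_ideal_complement charF0 fL ssL.
have [G [sG LG GK KG]] := compl K leib_sub leib_mull.
have subG x y : G x -> G y -> G (x ** y) by move=> _; apply: LG.
have anti x y : G x -> G y -> x ** y = - (y ** x).
  move=> Gx Gy; apply/eqP; rewrite -addr_eq0; apply/eqP/KG; first exact: leib_anti.
  by apply: (subD sG); apply: LG.
have mulG x y := @leib_complement_mul G x y GK.
have KD x : exists2 g, G g & K (x - g).
  have [u Ku Gxu] := GK x; exists (x - u) => //.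
  by rewrite opprB addrCA subrr addr0.
exists G; split; first split.
- by [].
- split=> [x Gx|x y z Gx Gy Gz].
    by apply: KG; [exact: leib_sq|exact: LG].
  rewrite (anti z x) // left_leibniz (anti z (x ** y)) //; last exact: LG.
  by rewrite lmulNr addrK subrr.
- exact: fin_dim_sub fL sG _.
- exact: semisimple_leib_complement ssL sG GK KG.
split.
  split.
    apply/seteqP; split=> // x _; have [u Ku Gxu] := GK x.
    by exists (x - u) => //; exists u => //; rewrite subrK.
  apply/seteqP; split=> [x [Gx Kx]|_ ->]; first exact: KG.
  by split; [exact: sub0|exact: (sub0 leib_sub)].
move=> K'.
(* Since [K] is killed by right multiplications and [x] acts from the left as its component in [G],
   the sub-bimodules of [K] are the left ideals of [L] contained in [K]. *)
have subbi N : N `<=` K -> subspace N -> (forall x y, N y -> N (x ** y)) ->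
    @subbimodule F L G (adjoint L) N.
  move=> NK sN NL; split; first by split=> // x m _; apply: NL.
  move=> x m _ /NK Km; rewrite [ract _ _](leib_mul0 x Km); exact: (sub0 sN).
have subbi_left (N : set L) : @subbimodule F L G (adjoint L) N -> forall x y, N y -> N (x ** y).
  move=> [[sN NG] _] x y Ny; have [g Gg ->] := mulG x y; exact: NG.
split.
- by apply: subbi => //; [exact: leib_sub|exact: leib_mull].
- exact: fin_dim_sub fL leib_sub _.
- apply: completely_reducible_complemented.
  + by move=> N [[sN _] _].
  + move=> N N' [[sN NG] NG'] [[sN' N'G] N'G']; split; first split.
    * exact: subspaceI.
    * by move=> x m Gx [Nm N'm]; split; [exact: NG|exact: N'G].
    * by move=> x m Gx [Nm N'm]; split; [exact: NG'|exact: N'G'].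
  + exact: fin_dim_sub fL leib_sub _.
  + by apply: subbi => //; [exact: leib_sub|exact: leib_mull].
  move=> N sbN NK; have [[sN _] _] := sbN.
  have [T [sT LT NT NT0]] := compl N sN (subbi_left N sbN).
  exists (T `&` K); split.
  + apply: subbi; [by move=> x []|exact: subspaceI leib_sub|].
    by move=> x y [Ty Ky]; split; [exact: LT|exact: leib_mull].
  + by move=> x [].
  + move=> x Kx; have [u Nu Txu] := NT x; exists u => //; split=> //.
    by apply: (subB leib_sub) => //; apply: NK.
  + by move=> x Nx [Tx _]; apply: NT0.
- by move=> x m _ Km; apply: leib_mul0.
move=> N sbN NK [Ntriv _]; have [[sN _] _] := sbN.
have [T [sT LT NT NT0]] := compl N sN (subbi_left N sbN).
(* With [y = (y - u) + u], the square of [y] is [y (y - u) + y u]: the first term is in the left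
   ideal [T], the second vanishes as [u] is in the trivial [N]. So [K] is in [T], which meets [N]
   only in 0. *)
have KT : K `<=` T.
  apply: (span_sub sT) => _ [y _ <-]; have [u Nu Tyu] := NT y.
  rewrite -{2}[y](subrK u) lmulDr; apply: (subD sT); first exact: LT.
  have [g Gg ->] := mulG y u; rewrite (Ntriv g u Gg Nu); exact: sub0.
apply/seteqP; split=> [x Nx|_ ->]; last exact: sub0.
by apply: NT0 => //; apply: KT; apply: NK.
Qed.

End Leibniz.

(** * Hemi-semidirect products *)

Definition bilinear_pack (F : fieldType) (U V W : lmodType F) (f : U -> V -> W)
    (bil_f : bilinear_for *:%R *:%R f) : {bilinear U -> V -> W} :=
  HB.pack f (bilinear_isBilinear.Build F U V W *:%R *:%R f bil_f).

Definition leibniz_pack (F : fieldType) n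
    (mul : {bilinear 'rV[F]_n -> 'rV[F]_n -> 'rV[F]_n})
    (mulE : forall x y z, mul x (mul y z) = mul (mul x y) z + mul y (mul x z)) :
    leibnizType F :=
  HB.pack 'rV[F]_n (isLeftLeibniz.Build F 'rV[F]_n mulE).

Definition left_module_pack (F : fieldType) (g : leibnizType F) k
    (act : {bilinear g -> 'rV[F]_k -> 'rV[F]_k})
    (actE : forall x y m, act (x ** y) m = act x (act y m) - act y (act x m)) :
    leftModType g :=
  HB.pack 'rV[F]_k (isLeftModule.Build F g 'rV[F]_k actE).

Section Derived.
Variables (F : fieldType) (L L' : leibnizType F) (f : L -> L').
Hypotheses (fL : linear f) (fM : forall x y, f (x ** y) = f x ** f y).

Lemma derived_image n (I : set L) : derived n (f @` I) `<=` f @` derived n I.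
Proof.
elim: n => [//|n IHn]; apply: span_sub.
  exact: (linear_image_subspace fL (span_subspace _)).
move=> _ [x /IHn[u Du <-] [y /IHn[v Dv <-] <-]]; exists (u ** v) => //.
by apply: mem_span; exists u => //; exists v.
Qed.

Lemma solvable_image (I : set L) : subspace I -> solvable I -> solvable (f @` I).
Proof.
move=> sI [n In0]; exists n; apply/seteqP; split=> [x /derived_image[u]|_ ->].
  by rewrite In0 => -> <-; exact: (linear_fun0 fL).
apply: derived0; exact: linear_image_subspace fL sI.
Qed.

End Derived.

Lemma lie_leib0 (F : fieldType) (L : leibnizType F) (G : set L) :
  lie G -> leib G `<=` [set 0].
Proof.
move=> [G2 _]; apply: span_sub; last by move=> _ [x Gx <-]; exact: G2.
by apply/subspaceP; split=> // a u v -> ->; rewrite scaler0 addr0.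
Qed.

Section Hemisemidirect.
Variables (F : fieldType) (L : leibnizType F) (G : set L).
Local Notation K := (leib [set: L]).

(** [g] and [M] have to be types, whereas [G] and [K] are sets: both are rebuilt on row vectors,
    with operations pulled back along the coordinates [j] and [i]. The inverses [jj] and [ii]
    default to 0 outside of [G] and [K]. *)
Lemma leib_decomposition_hemi :
         [/\ subalgebra G, lie G, fin_dim G & semisimple G] /\
         direct_sum2 [set: L] G (leib [set: L]) /\
         (let K : set (adjoint L) := leib [set: L] in
         [/\ subbimodule G K, fin_dim K,
             completely_reducible (@subbimodule F L G (adjoint L)) K,
             antisymmetric_bimod G K
           & forall N : set (adjoint L), subbimodule G N -> N `<=` K ->
               trivial_bimod G N -> N = [set 0]]) ->
  exists (g : leibnizType F) (M : leftModType g),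
         [/\ lie [set: g], fin_dim [set: g] & semisimple [set: g]] /\
         [/\ fin_dim [set: M],
             completely_reducible (@submodule F g [set: g] M) [set: M]
           & forall N : set M, submodule [set: g] N ->
               trivial_lmod [set: g] N -> N = [set 0]] /\
         isomorphic L (hemi M).
Proof.
move=> [[[sG GM] [G2 GJ] fG ssG] [[LGK GK] [[[sK GKK] _] fK crK _ trivK]]].
have [n [j [jL jI jG]]] := fin_dim_coord fG.
have [k [i [iL iI iK]]] := fin_dim_coord fK.
have Gj u : G (j u) by rewrite jG; exists u.
have Ki m : K (i m) by rewrite [leib _]iK; exists m.
have /choice[jj jjK] : forall x, exists u, G x -> j u = x.
  move=> x; have [Gx|nGx] := pselect (G x); last by exists 0.
  by move: Gx; rewrite {1}jG => -[u _ ux]; exists u.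
have /choice[ii iiK] : forall x, exists m, K x -> i m = x.
  move=> x; have [Kx|nKx] := pselect (K x); last by exists 0.
  by move: Kx; rewrite {1}[leib _]iK => -[m _ mx]; exists m.
pose mul u v := jj (j u ** j v).
have jM u v : j (mul u v) = j u ** j v by apply: jjK; apply: GM.
have mulB : bilinear_for *:%R *:%R mul.
  by split=> w a u v; apply: jI; rewrite jM !jL ?lmulDl ?lmulDr ?lmulZl ?lmulZr !jM.
pose mul' := bilinear_pack mulB.
have mulE u v w : mul' u (mul' v w) = mul' (mul' u v) w + mul' v (mul' u w).
  by apply: jI; rewrite (linear_funD jL) !jM; apply: left_leibniz.
pose g := leibniz_pack mulE.
pose act (u : g) m := ii (j u ** i m).
have iM u m : i (act u m) = j u ** i m by apply: iiK; apply: leib_mull.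
have actB : bilinear_for *:%R *:%R act.
  split=> w a u v; apply: iI; rewrite iM.
    by rewrite jL lmulDl lmulZl iL !iM.
  by rewrite !iL lmulDr lmulZr !iM.
pose act' := bilinear_pack actB.
have actE (u v : g) m : act' (u ** v) m = act' u (act' v m) - act' v (act' u m).
  apply: iI; rewrite (linear_funD iL) (linear_funN iL) !iM [j (u ** v)]jM.
  by rewrite [X in _ = X - _]left_leibniz addrK.
pose M := left_module_pack actE.
have fin_dim_rV r : fin_dim [set: 'rV[F]_r].
  by apply/fin_dimP; exists r, id; split; rewrite ?image_id.
(* The same maps, retyped on the packed structures [g] and [M]. *)
pose jg : g -> L := j; pose iM' : M -> L := i.
have jgL : linear jg := jL.
have iML : linear iM' := iL.
have jgM u v : jg (u ** v) = jg u ** jg v := jM u v.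
have iMM u m : iM' (lact u m) = jg u ** iM' m := iM u m.
have jgI : injective jg := jI.
have iMI : injective iM' := iI.
have jgK x : G x -> jg (jj x) = x := @jjK x.
exists g, M; split; first split.
- split=> [u _|u v w _ _ _]; apply: jgI; rewrite (linear_fun0 jgL).
    by rewrite jgM G2 //; apply: Gj.
  by rewrite !(linear_funD jgL) !jgM GJ //; apply: Gj.
- exact: fin_dim_rV.
- move=> I [sI _ HI] solI u Iu.
  have sjI : subspace (jg @` I) := linear_image_subspace jgL sI.
  have idjI : ideal G (jg @` I).
    split=> // [_ [v _ <-]|x _ Gx [v Iv <-]]; first exact: Gj.
    rewrite -(jgK x Gx) -!jgM; have [Iuv Ivu] := HI (jj x) v Logic.I Iv.
    by split; [exists ((jj x : g) ** v)|exists (v ** (jj x : g))].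
  have : leib G (jg u).
    by apply: (ssG _ idjI); [exact: (solvable_image jgL jgM sI solI)|exists u].
  move=> /(lie_leib0 (conj G2 GJ)) ju0.
  suff -> : u = 0 by apply: (sub0 (span_subspace _)).
  by apply: jgI; rewrite (linear_fun0 jgL).
have subE (N : set M) : submodule [set: g] N <-> @subbimodule F L G (adjoint L) (iM' @` N).
  split=> [[sN NG]|[[siN iNG] _]].
    have siN : subspace (iM' @` N) := linear_image_subspace iML sN.
    split; first split=> // x _ Gx [m Nm <-].
      by exists (lact (jj x : g) m); [exact: NG|rewrite iMM jgK].
    move=> x _ _ [m Nm <-]; rewrite [ract _ _](leib_mul0 _ (Ki m)); exact: sub0.
  split=> [|u m _ Nm].
    have -> : N = iM' @^-1` (iM' @` N).
      by apply/seteqP; split=> [x Nx|x [y Ny /iMI<-]//]; exists x.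
    exact: linear_preimage_subspace iML siN.
  have [|m' Nm'] := iNG (jg u) (iM' m) (Gj u); first by exists m.
  by move=> E; have /iMI<- := etrans E (esym (iMM u m)).
split; first split.
- exact: fin_dim_rV.
- apply: (completely_reducible_preimage (j := iM') iML iMI iK _ subE crK).
  by move=> N [[]].
- move=> N sN trN; have siN := (subE N).1 sN.
  have iN0 : iM' @` N = [set 0].
    apply: trivK => //; first by move=> _ [m _ <-]; apply: Ki.
    split=> x _ Gx [m Nm <-]; last exact: (leib_mul0 _ (Ki m)).
    rewrite -(jgK x Gx); apply: etrans (esym (iMM _ _)) _.
    by rewrite trN // (linear_fun0 iML).
  apply/seteqP; split=> [m Nm|_ ->]; last by have [sN' _] := sN; exact: sub0.
  apply: iMI; rewrite (linear_fun0 iML).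
  by have : (iM' @` N) (iM' m) by [exists m]; rewrite iN0.
have /choice[f fE] : forall x, exists um : hemi M, x = jg um.1 + iM' um.2.
  move=> x; have : [set: L] x by [].
  rewrite LGK => -[y Gy [z Kz <-]]; exists (jj y : g, ii z : M).
  by rewrite /= jgK // [iM' _](iiK z Kz).
have finj (u u' : g) (m m' : M) : jg u + iM' m = jg u' + iM' m' -> (u, m) = (u', m').
  move=> E; have : (G `&` K) (jg u - jg u').
    split; first by apply: (subB sG); apply: Gj.
    have -> : jg u - jg u' = iM' m' - iM' m.
      by apply/eqP; rewrite subr_eq addrAC eq_sym subr_eq addrC E addrC.
    by apply: (subB sK); apply: Ki.
  rewrite GK => /eqP; rewrite subr_eq0 => /eqP/jgI uu'; move: E; rewrite uu'.
  by move=> /addrI/iMI->.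
have fL : linear f.
  move=> a x y; have := fE (a *: x + y); rewrite {1}(fE x) {1}(fE y) => E.
  rewrite [LHS]surjective_pairing; apply: finj; rewrite -E /= jgL iML.
  by rewrite scalerDr addrACA.
pose fl := GRing.isLinear.Build _ _ _ _ f fL.
pose fLin : {linear L -> hemi M} := HB.pack f fl.
exists fLin; split.
  exists (fun um => jg um.1 + iM' um.2) => [x|[u m]] /=; first by rewrite -fE.
  by rewrite [LHS]surjective_pairing; apply: finj; rewrite -fE.
move=> x y /=; rewrite [LHS]surjective_pairing; apply: finj; rewrite -fE.
(* The component of [x] in [K] multiplies to zero from the left; what remains is the hemi-semidirect
   product. *)
rewrite jgM iMM {1}(fE x) {1}(fE y) lmulDl (leib_mul0 _ (Ki _)) addr0.
by rewrite lmulDr.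
Qed.
End Hemisemidirect.

Section HemiSemisimple.
Variables (F : fieldType) (g : leibnizType F) (M : leftModType g).

Lemma hemi_fin_dim : fin_dim [set: g] -> fin_dim [set: M] -> fin_dim [set: hemi M].
Proof.
case/fin_dimP=> a [p [pL pT]] /fin_dimP[b [q [qL qT]]].
apply/fin_dimP; exists (a + b)%N, (fun u => (p (lsubmx u), q (rsubmx u))); split.
  by move=> c u v; rewrite !linearP pL qL.
apply/seteqP; split=> // -[x m] _.
have : [set: g] x by []; rewrite pT => -[u _ <-].
have : [set: M] m by []; rewrite qT => -[v _ <-].
by exists (row_mx u v); rewrite ?row_mxKl ?row_mxKr.
Qed.

(** In an irreducible summand the span of all [lact u m] is a submodule; it is not zero, as the
    summand would then be trivial, so it is the whole summand. *)
Lemma acting_span (x : M) :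
    completely_reducible (@submodule F g [set: g] M) [set: M] ->
    (forall N : set M, submodule [set: g] N -> trivial_lmod [set: g] N -> N = [set 0]) ->
  span [set lact u m | u in [set: g] & m in [set: M]] x.
Proof.
set A := [set lact u m | u in _ & m in _] => -[I [N [irrN [NT _]]]] trM.
have : [set: M] x by []; rewrite NT; apply: span_sub; first exact: span_subspace.
move=> m [i _ Nm]; have [[sN gN] N0 irr] := irrN i.
pose B := span [set lact u m | u in [set: g] & m in N i].
have BN : B `<=` N i by apply: span_sub => // _ [u _ [m' Nm' <-]]; apply: gN.
have subB : submodule [set: g] B.
  split=> [|u m' _ /BN Nm']; first exact: span_subspace.
  by apply: mem_span; exists u => //; exists m'.
have [B0|BE] := irr B subB BN.
  case: N0; apply: trM => // u m' _ Nm'.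
  have : B (lact u m') by apply: mem_span; exists u => //; exists m'.
  by rewrite B0.
have : B m by rewrite BE.
apply: span_sub; first exact: span_subspace.
by move=> _ [u _ [m' _ <-]]; apply: mem_span; exists u => //; exists m'.
Qed.

Lemma hemi_isomorphic_semisimple (L : leibnizType F) :
         [/\ lie [set: g], fin_dim [set: g] & semisimple [set: g]] /\
         [/\ fin_dim [set: M],
             completely_reducible (@submodule F g [set: g] M) [set: M]
           & forall N : set M, submodule [set: g] N ->
               trivial_lmod [set: g] N -> N = [set 0]] /\
         isomorphic L (hemi M) ->
  fin_dim [set: L] /\ semisimple [set: L].
Proof.
move=> [[lie_g fg ssg] [[fM crM trM] [f [[f' fK f'K] fM']]]].
have fL : linear f by exact: linearP.
have f'L : linear f' by move=> a u v; apply: (can_inj fK); rewrite fL !f'K.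
split.
  have /fin_dimP[k [p [pL pT]]] := hemi_fin_dim fg fM.
  apply/fin_dimP; exists k, (f' \o p); split.
    by move=> a u v; rewrite /= pL f'L.
  apply/seteqP; split=> // x _; have : [set: hemi M] (f x) by [].
  by rewrite pT => -[u _ ux]; exists u; rewrite //= ux fK.
move=> I [sI _ HI] solI x Ix.
pose h y := (f y).1.
have hL : linear h by move=> a u v; rewrite /h fL.
have hM u v : h (u ** v) = h u ** h v by rewrite /h fM'.
have : (h @` I) (h x) by exists x.
(* [h] is onto, so it maps ideals to ideals. *)
have idh : ideal [set: g] (h @` I).
  split=> //; first exact: linear_image_subspace hL sI.
  move=> u _ _ [v Iv <-]; have -> : u = h (f' (u, 0)) by rewrite /h f'K.
  rewrite -!hM; have [H1 H2] := HI (f' (u, 0)) v Logic.I Iv.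
  by split; [exists (f' (u, 0) ** v)|exists (v ** f' (u, 0))].
move/(ssg _ idh (solvable_image hL hM sI solI))/(lie_leib0 lie_g) => hx0.
have -> : x = f' (0, (f x).2) by rewrite -[LHS]fK [f x]surjective_pairing [(f x).1]hx0.
pose i m := f' ((0, m) : hemi M).
have iL : linear i.
  by move=> a u v; rewrite -f'L; congr f'; congr pair; rewrite /= scaler0 addr0.
suff : [set m | leib [set: L] (i m)] (f x).2 by [].
move: (f x).2 => m; apply: (span_sub _ _ (acting_span m crM trM)).
  exact: (linear_preimage_subspace iL (leib_sub L)).
(* The square of [(u, m')] is [(u u, u m') = (0, u m')], since [g] is a Lie algebra. *)
move=> _ [u _ [m' _ <-]] /=; apply: mem_span; exists (f' (u, m')) => //.
apply: (can_inj fK); rewrite fM' !f'K; congr pair => /=.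
exact: lie_g.1.
Qed.

End HemiSemisimple.

Theorem theorem3p1 (F : fieldType) (charF0 : [pchar F] =i pred0)
    (L : leibnizType F) :
  [<-> fin_dim [set: L] /\ semisimple [set: L];
       exists G : set L,
         [/\ subalgebra G, lie G, fin_dim G & semisimple G] /\
         direct_sum2 [set: L] G (leib [set: L]) /\
         let K : set (adjoint L) := leib [set: L] in
         [/\ subbimodule G K, fin_dim K,
             completely_reducible (@subbimodule F L G (adjoint L)) K,
             antisymmetric_bimod G K
           & forall N : set (adjoint L), subbimodule G N -> N `<=` K ->
               trivial_bimod G N -> N = [set 0]];
       exists (g : leibnizType F) (M : leftModType g),
         [/\ lie [set: g], fin_dim [set: g] & semisimple [set: g]] /\
         [/\ fin_dim [set: M],
             completely_reducible (@submodule F g [set: g] M) [set: M]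
           & forall N : set M, submodule [set: g] N ->
               trivial_lmod [set: g] N -> N = [set 0]] /\
         isomorphic L (hemi M)].
Proof.
tfae.
- exact: leib_decomposition.
- by case=> G; apply: leib_decomposition_hemi.
- by case=> g [M]; apply: hemi_isomorphic_semisimple.
Qed.
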